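(* Let $D$ be the closed unit disk. Each of the following partial (multivalued) functions, all defined on those $f\in\mathcal C(D)$ that are restrictions to $D$ of polynomials $P\in\mathbb C[X]$, is Weihrauch equivalent to $\mathrm C_{\mathbb N}$: (1) $\deg_{\mathcal C}:\subseteq\mathcal C(D)\to\mathbb N$, $f\mapsto\deg P$; (2) $\operatorname{dbnd}_{\mathcal C}:\subseteq\mathcal C(D)\rightrightarrows\mathbb N$, where $n$ is a valid output iff $n\ge\deg P$; (3) $\operatorname{Adv}_c|_{\mathbb C[X]}:\subseteq\mathcal C(D)\rightrightarrows\mathbb N$, $f\mapsto\{m\in\mathbb N\mid f\text{ extends analytically to the closure of }U_m\text{ with extension bounded in absolute value by }m\}$, where $U_m$ is the open disk of radius $2^{1/(m+1)}$ around $0$.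
   Context: Represented spaces: sets with partial surjections from $\mathbb{N}^{\mathbb{N}}$. A realizer of $f:\subseteq\mathbf X\rightrightarrows\mathbf Y$ is a partial $F$ on $\mathbb{N}^{\mathbb{N}}$ with $\delta_{\mathbf Y}(F(p))\in f(\delta_{\mathbf X}(p))$ whenever $\delta_{\mathbf X}(p)\in\operatorname{dom}f$. $f\le_W g$ iff there are computable partial $H:\subseteq\mathbb{N}^{\mathbb{N}}\to\mathbb{N}^{\mathbb{N}}$, $K:\subseteq\mathbb{N}^{\mathbb{N}}\times\mathbb{N}^{\mathbb{N}}\to\mathbb{N}^{\mathbb{N}}$ with $p\mapsto K(p,G(H(p)))$ realizing $f$ for every realizer $G$ of $g$; $\equiv_W$ is reducibility both ways. $\mathbb N$ is represented by $p\mapsto p(0)$; $\mathcal A(\mathbb N)$: $p$ names $A$ iff $\mathbb N\setminus A=\{p(n)-1\mid p(n)>0\}$; $\mathrm C_{\mathbb N}$ maps a nonempty $A\in\mathcal A(\mathbb N)$ to any element of $A$. $\mathcal C(D)$: continuous $D\to\mathbb C$ with metric representation ($p$ names $f$ iff $\|f-q_{p(n)}\|_\infty<2^{-n}$ for all $n$, $(q_n)$ a standard enumeration of polynomials with rational coefficients). *)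

(* Defs.v *)
From HB Require Import structures.
From mathcomp Require Import all_boot all_order all_algebra.
From mathcomp Require Import all_classical all_reals all_analysis.
From mathcomp Require Import complex.
From mathcomp Require Import ring lra.

Set Implicit Arguments.
Unset Strict Implicit.
Unset Printing Implicit Defensive.

Import Order.TTheory GRing.Theory Num.Theory.
Import numFieldNormedType.Exports.

Local Open Scope classical_set_scope.
Local Open Scope ring_scope.

(** * Computable partial functions on Baire space *)

Definition baire : Type := nat -> nat.

(** Kleene's mu-recursive functions relative to an oracle.  Arities are not
    tracked: a program acts on a list of arguments, missing ones being read
    as 0. *)
Inductive oprog : Type :=
| OZero
| OSucc
| OProj of nat
| OQuery
| OComp of oprog & seq oprog
| ORec of oprog & oprog
| OMu of oprog.

(** [oeval p e xs y]: program [e] with oracle [p] halts on [xs] with value [y]. *)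
Inductive oeval (p : baire) : oprog -> seq nat -> nat -> Prop :=
| oeval_zero xs : oeval p OZero xs 0%N
| oeval_succ xs : oeval p OSucc xs (nth 0%N xs 0).+1
| oeval_proj i xs : oeval p (OProj i) xs (nth 0%N xs i)
| oeval_query xs : oeval p OQuery xs (p (nth 0%N xs 0))
| oeval_comp f gs xs ys y :
    size ys = size gs ->
    (forall i, (i < size gs)%N -> oeval p (nth OZero gs i) xs (nth 0%N ys i)) ->
    oeval p f ys y ->
    oeval p (OComp f gs) xs y
| oeval_rec0 f g xs y :
    oeval p f xs y ->
    oeval p (ORec f g) (0%N :: xs) y
| oeval_recS f g n xs y z :
    oeval p (ORec f g) (n :: xs) y ->
    oeval p g (n :: y :: xs) z ->
    oeval p (ORec f g) (n.+1 :: xs) z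
| oeval_mu f xs n (ys : nat -> nat) :
    oeval p f (n :: xs) 0%N ->
    (forall m, (m < n)%N -> oeval p f (m :: xs) (ys m).+1) ->
    oeval p (OMu f) xs n.

(** A partial function on Baire space is computable when one program computes
    it at every point of its domain; as usual in computable analysis, nothing
    is required outside the domain. *)
Definition computable1 (F : baire -> option baire) : Prop :=
  exists e : oprog, forall p q, F p = Some q ->
    forall n, oeval p e [:: n] (q n).

Definition baire_join (p q : baire) : baire :=
  fun n => if odd n then q n./2 else p n./2.

Definition computable2 (F : baire -> baire -> option baire) : Prop :=
  exists e : oprog, forall p q r, F p q = Some r ->
    forall n, oeval (baire_join p q) e [:: n] (r n).

(** * Represented spaces and Weihrauch reducibility *)

(** The partial surjection from Baire space onto the carrier is given by its
    graph [names]. *)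
Record rep_space : Type := RepSpace {
  carrier :> Type;
  names : baire -> carrier -> Prop;
  names_fun : forall p x y, names p x -> names p y -> x = y;
  names_surj : forall x, exists p, names p x }.

Record problem (X Y : rep_space) : Type := Problem {
  dom : set X;
  sol : X -> set Y }.

Definition realizes (X Y : rep_space) (F : baire -> option baire)
    (f : problem X Y) : Prop :=
  forall p x, names p x -> dom f x ->
    exists q y, [/\ F p = Some q, names q y & sol f x y].

Definition weihrauch_le (X Y Z W : rep_space)
    (f : problem X Y) (g : problem Z W) : Prop :=
  exists (H : baire -> option baire) (K : baire -> baire -> option baire),
    [/\ computable1 H, computable2 K &
      forall G, realizes G g ->
        realizes (fun p => obind (K p) (obind G (H p))) f].

Definition weihrauch_equiv (X Y Z W : rep_space)
    (f : problem X Y) (g : problem Z W) : Prop :=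
  weihrauch_le f g /\ weihrauch_le g f.

(** * Natural numbers, closed sets of natural numbers, closed choice *)

Definition nat_names (p : baire) (n : nat) : Prop := p 0%N = n.

Lemma nat_names_fun p m n : nat_names p m -> nat_names p n -> m = n.
Proof. by move=> <-. Qed.

Lemma nat_names_surj n : exists p, nat_names p n.
Proof. by exists (fun=> n). Qed.

Definition nat_space : rep_space := RepSpace nat_names_fun nat_names_surj.

Definition closed_names (p : baire) (A : set nat) : Prop :=
  ~` A = [set k | exists n, (0 < p n)%N /\ k = (p n).-1].

Lemma closed_names_fun p A B : closed_names p A -> closed_names p B -> A = B.
Proof. by rewrite /closed_names => <- /(congr1 setC); rewrite !setCK. Qed.

Lemma closed_names_surj A : exists p, closed_names p A.
Proof.
exists (fun n => if n \in A then 0%N else n.+1); apply/seteqP; split=> k /=.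
- by move=> nAk; exists k; rewrite ifN// ; apply/negP; rewrite inE.
- by move=> [n []]; case: ifPn => // /negP; rewrite inE => nAn _ ->.
Qed.

Definition closed_space : rep_space :=
  RepSpace closed_names_fun closed_names_surj.

Definition closed_choice : problem closed_space nat_space :=
  @Problem closed_space nat_space (fun A => A !=set0) (fun A => A).

(** * Continuous functions on the closed unit disk *)

HB.instance Definition _ (R : realType) := NormedModule.copy R[i] R[i]^o.

Definition cabs (R : realType) (z : R[i]) : R := ComplexField.Normc.normc z.
Arguments cabs : simpl never.

Definition disk (R : realType) : set R[i] := [set z | cabs z <= 1].
Arguments disk : clear implicits.

(** Every element of Q(i) is of this form. *)
Definition gauss (R : realType) (c : nat) : R[i] :=
  let s := CodeSeq.decode c in
  ((nth 0%N s 0)%:R - (nth 0%N s 1)%:R + 'i%C * ((nth 0%N s 2)%:R - (nth 0%N s 3)%:R))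
    / (nth 0%N s 4).+1%:R.

(** The [n]-th polynomial with rational coefficients.  For these to be dense
    among the continuous complex functions on the disk (as a metric
    representation requires) they have to be polynomials in both real
    coordinates of the argument, with coefficients in Q(i).  They are written
    here in the equivalent variables [z] and its conjugate; the number [n]
    codes the finite matrix of coefficients as a list of lists. *)
Definition ratpoly (R : realType) (n : nat) (z : R[i]) : R[i] :=
  let rows := map CodeSeq.decode (CodeSeq.decode n) in
  \sum_(j < size rows) \sum_(k < size (nth [::] rows j))
    gauss R (nth 0%N (nth [::] rows j) k) * z ^+ j * z^* ^+ k.

(** ** Density of [ratpoly], by two-dimensional Bernstein approximation *)

(** [bern x n g] is the expectation of [g k] for [k] binomial with parameters
    [n] and [x]. *)
Fixpoint bern (A : comNzRingType) (x : A) (n : nat) (g : nat -> A) : A :=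
  if n is m.+1 then (1 - x) * bern x m g + x * bern x m (g \o succn) else g 0%N.

Lemma bern_morph (A B : comNzRingType) (h : {rmorphism A -> B}) x n g :
  h (bern x n g) = bern (h x) n (h \o g).
Proof.
elim: n g => //= n IH g.
by rewrite rmorphD !rmorphM rmorphB rmorph1 !IH.
Qed.

Lemma bernD (A : comNzRingType) (x : A) n g1 g2 :
  bern x n (fun k => g1 k + g2 k) = bern x n g1 + bern x n g2.
Proof.
elim: n g1 g2 => //= n IH g1 g2; rewrite IH.
rewrite [X in _ + x * X = _](IH (g1 \o succn) (g2 \o succn)); ring.
Qed.

Lemma bernZ (A : comNzRingType) (x : A) n c g :
  bern x n (fun k => c * g k) = c * bern x n g.
Proof.
elim: n g => //= n IH g; rewrite IH.
rewrite [X in _ + x * X = _](IH (g \o succn)); ring.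
Qed.

Lemma bern_cst (A : comNzRingType) (x : A) n c : bern x n (fun=> c) = c.
Proof.
elim: n => //= n IH.
have IH' : bern x n ((fun=> c) \o succn) = c by [].
by rewrite ?IH' ?IH; ring.
Qed.

Lemma bern_var (A : comNzRingType) (x : A) n a :
  bern x n (fun k => (k%:R - a) ^+ 2) = (n%:R * x - a) ^+ 2 + n%:R * (x * (1 - x)).
Proof.
elim: n a => [|n IH] a /=; first by ring.
rewrite IH.
have -> : (fun k => (k%:R - a) ^+ 2) \o succn = (fun k => (k%:R - (a - 1)) ^+ 2) :> (_ -> A).
  by apply/funext => k /=; rewrite -natr1; ring.
by rewrite IH -natr1; ring.
Qed.

Lemma ler_bern (R : realType) (x : R) n g1 g2 : 0 <= x <= 1 ->
  (forall k, g1 k <= g2 k) -> bern x n g1 <= bern x n g2.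
Proof.
move=> /andP[x0 x1]; elim: n g1 g2 => //= n IH g1 g2 g12.
by apply: lerD; apply: ler_wpM2l; rewrite ?subr_ge0// ; apply: IH => // k; apply: g12.
Qed.

Lemma cabsE (R : realType) (z : R[i]) : `|z| = (cabs z)%:C%C.
Proof. by rewrite normc_def; case: z. Qed.

Lemma cabs_ge0 (R : realType) (z : R[i]) : 0 <= cabs z.
Proof. by rewrite /cabs; case: z => a b; exact: sqrtr_ge0. Qed.

Lemma ler_cabsD (R : realType) (z w : R[i]) : cabs (z + w) <= cabs z + cabs w.
Proof. by rewrite -lecR rmorphD /= -!cabsE ler_normD. Qed.

Lemma cabsR (R : realType) (x : R) : cabs x%:C%C = `|x|.
Proof. by rewrite /cabs /= expr0n /= addr0 sqrtr_sqr. Qed.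

Lemma cabsM (R : realType) (z w : R[i]) : cabs (z * w) = cabs z * cabs w.
Proof. exact: ComplexField.Normc.normcM. Qed.

Lemma cabs_distC (R : realType) (z w : R[i]) : cabs (z - w) = cabs (w - z).
Proof. by apply: complexI; rewrite -!cabsE distrC. Qed.

Lemma ler_cabs_dist (R : realType) (v z w : R[i]) : cabs (z - w) <= cabs (z - v) + cabs (v - w).
Proof. by have -> : z - w = (z - v) + (v - w); [ring|exact: ler_cabsD]. Qed.

Lemma sqr_cabs (R : realType) (z : R[i]) : cabs z ^+ 2 = complex.Re z ^+ 2 + complex.Im z ^+ 2.
Proof. by rewrite /cabs; case: z => a b /=; rewrite sqr_sqrtr// addr_ge0 ?sqr_ge0. Qed.

Lemma ltr_cabs (R : realType) (z : R[i]) (d : R) : 0 <= d ->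
  (cabs z < d) = (complex.Re z ^+ 2 + complex.Im z ^+ 2 < d ^+ 2).
Proof. by move=> d0; rewrite -sqr_cabs ltr_sqr ?nnegrE ?cabs_ge0. Qed.

Lemma ler_cabs (R : realType) (z : R[i]) (d : R) : 0 <= d ->
  (cabs z <= d) = (complex.Re z ^+ 2 + complex.Im z ^+ 2 <= d ^+ 2).
Proof. by move=> d0; rewrite -sqr_cabs ler_sqr ?nnegrE ?cabs_ge0. Qed.

Lemma cabs_bern (R : realType) (x : R) n (g : nat -> R[i]) : 0 <= x <= 1 ->
  cabs (bern x%:C%C n g) <= bern x n (fun k => cabs (g k)).
Proof.
move=> /andP[x0 x1]; elim: n g => //= n IH g.
apply: (le_trans (ler_cabsD _ _)); rewrite !cabsM.
have -> : 1 - x%:C%C = (1 - x)%:C%C by rewrite rmorphB rmorph1.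
rewrite !cabsR !ger0_norm ?subr_ge0//.
by apply: lerD; apply: ler_wpM2l; rewrite ?subr_ge0//; apply: IH.
Qed.

Lemma modulus (R : realType) (f : R[i] -> R[i]) :
  (forall z, cabs z <= 1 -> forall e : R, 0 < e -> exists2 d : R, 0 < d &
     forall w, cabs w <= 1 -> cabs (w - z) < d -> cabs (f w - f z) < e) ->
  forall e : R, 0 < e -> exists2 M : R, 0 <= M & forall z w, cabs z <= 1 -> cabs w <= 1 ->
    cabs (f w - f z) <= e + M * cabs (w - z) ^+ 2.
Proof.
move=> cf.
pose c (t : R * R) : R[i] := (t.1 +i* t.2)%C.
pose K := [set t : R * R | cabs (c t) <= 1].
have cabs_small (t u : R * R) d : 0 < d -> ball t d u -> cabs (c u - c t) < 2 * d.
  move=> d0 [/= b1 b2]; rewrite ltr_cabs ?mulr_ge0 ?ltW//=.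
  move: b1 b2; rewrite /ball /= !ltr_norml => /andP[b1 b2] /andP[b3 b4]; nra.
have cK : compact K.
  have sK : K `<=` `[-1, 1]%classic `*` `[-1, 1]%classic.
    move=> [u v]; rewrite /K /= ler_cabs //=.
    by move=> h; rewrite !in_itv /=; split; apply/andP; split; nra.
  apply: (subclosed_compact _ _ sK); last first.
    by apply: compact_setX; exact: segment_compact.
  have -> : K = (fun t : R * R => t.1 ^+ 2 + t.2 ^+ 2) @^-1` [set x | x <= 1].
    apply/seteqP; split=> t; rewrite /K /= ler_cabs //=;
    by rewrite expr1n.
  apply: closed_comp; last exact: closed_le.
  move=> t _; apply: cvgD; rewrite expr2; apply: cvgM;
    by [exact: cvg_fst|exact: cvg_snd].
have nc : near_covering_within K by apply/near_covering_withinP/compact_near_coveringP.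
have cRe (z : R[i]) : c (complex.Re z, complex.Im z) = z by case: z.
have locd (t : R * R) e : K t -> 0 < e -> exists2 d, 0 < d & forall u w,
    ball t d u -> K u -> cabs w <= 1 -> cabs (w - c u) < d -> cabs (f w - f (c u)) < e.
  move=> Kt e0; have e20 : 0 < e / 2 by rewrite divr_gt0.
  have [d d0 dP] := cf _ Kt _ e20; exists (d / 3); first by rewrite divr_gt0.
  move=> u w /cabs_small tu Ku Kw wu.
  have {}tu : cabs (c u - c t) < 2 * (d / 3) by apply: tu; rewrite divr_gt0.
  have h1 : cabs (f (c u) - f (c t)) < e / 2 by apply: dP => //; lra.
  have h2 : cabs (f w - f (c t)) < e / 2.
    by apply: dP => //; apply: (le_lt_trans (ler_cabs_dist (c u) _ _)); lra.
  by apply: (le_lt_trans (ler_cabs_dist (f (c t)) _ _)); rewrite [X in _ + X]cabs_distC; lra.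
have [B BP] : exists B, forall z, cabs z <= 1 -> cabs (f z) <= B.
  have loc t : K t -> \forall t' \near t & B \near +oo%R, K t' -> cabs (f (c t')) <= B.
    move=> Kt; have [d d0 dP] := locd t 1 Kt ltr01.
    exists (ball t (d / 2), [set B : R | cabs (f (c t)) + 1 <= B]).
      split; [by apply: nbhsx_ballx; rewrite divr_gt0|apply: nbhs_pinfty_ge; exact: num_real].
    move=> [u b] [/= tu le_b] Ku; apply: le_trans le_b.
    have d20 : 0 < d / 2 by rewrite divr_gt0.
    have cu : cabs (c u - c t) < d.
      by have := cabs_small t u (d / 2) d20 tu; have -> : 2 * (d / 2) = d by field.
    have tt : ball t d t by exact: ballxx.
    have := dP t (c u) tt Kt Ku cu.
    by have := ler_cabsD (f (c u) - f (c t)) (f (c t)); rewrite subrK; lra.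
  have [B BP] := filter_ex (nc R +oo%R (fun B t => cabs (f (c t)) <= B) _ loc).
  by exists B => z z1; have := BP (complex.Re z, complex.Im z); rewrite /K /= cRe; apply.
move=> e e0.
pose P (M : R) t := 0 <= M /\ forall w, cabs w <= 1 ->
  cabs (f w - f (c t)) <= e + M * cabs (w - c t) ^+ 2.
have loc t : K t -> \forall t' \near t & M \near +oo%R, K t' -> P M t'.
  move=> Kt; have [d d0 dP] := locd t e Kt e0.
  have B0 : 0 <= B by apply: le_trans (BP 0 _); rewrite ?cabs_ge0 // cabsR normr0.
  exists (ball t d, [set M : R | (2 * B) / d ^+ 2 <= M]).
    by split; [exact: nbhsx_ballx|apply: nbhs_pinfty_ge; exact: num_real].
  move=> [u M] [/= tu le_M] Ku.
  have M0 : 0 <= M by apply: le_trans le_M; rewrite divr_ge0 ?sqr_ge0 ?mulr_ge0.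
  split=> // w w1; have [wu|uw] := ltP (cabs (w - c u)) d.
    apply: (le_trans (ltW (dP u w tu Ku w1 wu))).
    by rewrite lerDl mulr_ge0 ?sqr_ge0.
  have h1 : cabs (f w - f (c u)) <= 2 * B.
    apply: (le_trans (ler_cabs_dist 0 _ _)); rewrite subr0 [X in _ + X]cabs_distC subr0.
    by have := BP w w1; have := BP (c u) Ku; lra.
  have h2 : 2 * B <= M * d ^+ 2 by rewrite -ler_pdivrMr // exprn_gt0.
  have h3 : M * d ^+ 2 <= M * cabs (w - c u) ^+ 2.
    by apply: ler_wpM2l => //; rewrite ler_sqr ?nnegrE ?cabs_ge0 // ltW.
  lra.
have [M MP] := filter_ex (nc R +oo%R P _ loc).
exists M; first by have [] := MP (0, 0); rewrite // /K /= (cabsR 0) normr0.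
move=> z w z1 w1; have := MP (complex.Re z, complex.Im z).
by rewrite /K /P /= !cRe => /(_ z1)[_]; apply.
Qed.

Definition disk_retract (R : realType) (w : R[i]) : R[i] :=
  if cabs w <= 1 then w else w / (cabs w)%:C%C.

Lemma disk_retract1 (R : realType) (w : R[i]) : cabs (disk_retract w) <= 1.
Proof.
rewrite /disk_retract; case: ifPn => //; rewrite -ltNge => w1.
by rewrite cabsM -fmorphV cabsR ger0_norm ?invr_ge0 ?cabs_ge0 // divff // gt_eqF // (lt_trans ltr01).
Qed.

Lemma disk_retract_dist (R : realType) (w z : R[i]) : cabs z <= 1 ->
  cabs (disk_retract w - z) <= 2 * cabs (w - z).
Proof.
move=> z1; rewrite /disk_retract; case: ifPn => [_|].
  by rewrite ler_peMl ?cabs_ge0 // ler1n.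
rewrite -ltNge => w1.
have w0 : 0 < cabs w by apply: lt_trans w1.
apply: (le_trans (ler_cabs_dist w _ _)).
have -> : w / (cabs w)%:C%C - w = w * ((cabs w)^-1 - 1)%:C%C.
  by rewrite rmorphB rmorph1 /= fmorphV mulrBr mulr1.
rewrite cabsM cabsR ler0_norm; last by rewrite subr_le0 invf_le1 // ltW.
have -> : cabs w * - ((cabs w)^-1 - 1) = cabs w - 1 by field; rewrite gt_eqF.
by have := ler_cabsD (w - z) z; rewrite subrK; lra.
Qed.

Lemma complex_split (R : realType) (z : R[i]) :
  z = (complex.Re z)%:C%C + 'i%C * (complex.Im z)%:C%C.
Proof. by case: z => a b; apply/eqP; rewrite eq_complex /=; apply/andP; split; apply/eqP; ring. Qed.

Lemma conj_split (R : realType) (z : R[i]) :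
  z^* = (complex.Re z)%:C%C - 'i%C * (complex.Im z)%:C%C.
Proof. by case: z => a b; apply/eqP; rewrite eq_complex /=; apply/andP; split; apply/eqP; ring. Qed.

Lemma cabs_conj (R : realType) (z : R[i]) : cabs z^* = cabs z.
Proof. by rewrite /cabs; case: z => a b /=; rewrite sqrrN. Qed.

Lemma cabs_i (R : realType) : cabs ('i%C : R[i]) = 1.
Proof. by rewrite /cabs /= expr0n expr1n /= add0r sqrtr1. Qed.

Lemma cabsX (R : realType) (z : R[i]) n : cabs (z ^+ n) = cabs z ^+ n.
Proof. by elim: n => [|n IH]; rewrite ?expr0 ?(cabsR 1) ?normr1 // !exprS cabsM IH. Qed.

Lemma cabs_sum (R : realType) (I : Type) (r : seq I) (F : I -> R[i]) :
  cabs (\sum_(i <- r) F i) <= \sum_(i <- r) cabs (F i).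
Proof.
elim/big_rec2: _ => [|i x y _ h]; first by rewrite (cabsR 0) normr0.
by apply: (le_trans (ler_cabsD _ _)); rewrite lerD2l.
Qed.

Definition ev2 (R : realType) (P : {poly {poly R[i]}}) (z : R[i]) : R[i] := P.[z%:P].[z^*].

Lemma poly_dense (R : realType) (f : R[i] -> R[i]) :
  (forall z, cabs z <= 1 -> forall e : R, 0 < e -> exists2 d : R, 0 < d &
     forall w, cabs w <= 1 -> cabs (w - z) < d -> cabs (f w - f z) < e) ->
  forall e : R, 0 < e -> exists P : {poly {poly R[i]}},
    forall z, cabs z <= 1 -> cabs (f z - ev2 P z) <= e.
Proof.
move=> cf e e0; have e20 : 0 < e / 2 by rewrite divr_gt0.
have [M M0 MP] := modulus cf e20.
have [n nP] : exists n : nat, 32 * M / e < n.+1%:R.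
  by exists (Num.truncn (32 * M / e)); exact: truncnS_gt.
pose w k l : R[i] := ((2 * k%:R / n.+1%:R - 1) +i* (2 * l%:R / n.+1%:R - 1))%C.
pose cst (c : R[i]) : {poly {poly R[i]}} := c%:P%:P.
pose Px := cst (2^-1) + cst (4^-1) * ('X + 'X%:P).
pose Py := cst (2^-1) - cst ('i%C / 4) * ('X - 'X%:P).
exists (bern Px n.+1 (fun k => bern Py n.+1 (fun l => cst (f (disk_retract (w k l)))))) => z z1.
pose x := (1 + complex.Re z) / 2; pose y := (1 + complex.Im z) / 2.
have := z1; rewrite ler_cabs //= expr1n => z1'.
have x01 : 0 <= x <= 1 by rewrite /x; apply/andP; split; nra.
have y01 : 0 <= y <= 1 by rewrite /y; apply/andP; split; nra.
have evcst c : ev2 (cst c) z = c by rewrite /ev2 /cst !hornerE.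
have i2 : 'i%C * 'i%C = -1 :> R[i] by exact: (@sqr_i R).
have evPx : ev2 Px z = x%:C%C.
  rewrite /ev2 /Px /cst !hornerE /= {1}(complex_split z) conj_split /x.
  by rewrite rmorphM fmorphV /= rmorphD !rmorph1 rmorph_nat; field.
have evPy : ev2 Py z = y%:C%C.
  rewrite /ev2 /Py /cst !hornerE /= {1}(complex_split z) conj_split /y.
  rewrite rmorphM fmorphV /= rmorphD !rmorph1 rmorph_nat.
  set t := (complex.Im z)%:C%C; set r := (complex.Re z)%:C%C.
  transitivity (2^-1 - ('i%C * 'i%C) * t / 2); first by field.
  by rewrite i2; field.
have evB X (g : nat -> {poly {poly R[i]}}) : ev2 (bern X n.+1 g) z = bern (ev2 X z) n.+1 (fun k => ev2 (g k) z).
  by rewrite /ev2 -!horner_evalE !bern_morph.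
have -> : ev2 (bern Px n.+1 (fun k => bern Py n.+1 (fun l => cst (f (disk_retract (w k l)))))) z =
    bern x%:C%C n.+1 (fun k => bern y%:C%C n.+1 (fun l => f (disk_retract (w k l)))).
  rewrite evB evPx; congr bern; apply/funext => k.
  by rewrite evB evPy; congr bern; apply/funext => l; rewrite evcst.
have -> : f z - bern x%:C%C n.+1 (fun k => bern y%:C%C n.+1 (fun l => f (disk_retract (w k l)))) =
    - bern x%:C%C n.+1 (fun k => bern y%:C%C n.+1 (fun l => f (disk_retract (w k l)) + (- f z))).
  rewrite (_ : (fun k => bern _ _ (fun l => _ + _)) =
    (fun k => bern y%:C%C n.+1 (fun l => f (disk_retract (w k l))) + - f z)); last first.
    apply/funext => k.
    by rewrite (bernD _ _ (fun l => f (disk_retract (w k l))) (fun=> - f z)) bern_cst.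
  rewrite (bernD _ _ (fun k => bern y%:C%C n.+1 (fun l => f (disk_retract (w k l)))) (fun=> - f z)).
  by rewrite bern_cst opprB.
rewrite -[X in cabs X]sub0r cabs_distC subr0.
apply: (le_trans (cabs_bern _ _ x01)).
have N0 : 0 < n.+1%:R :> R by rewrite ltr0n.
pose c := 4 * M * (4 / n.+1%:R ^+ 2).
pose a := n.+1%:R * x; pose b := n.+1%:R * y.
have step k l : cabs (f (disk_retract (w k l)) + - f z) <= e / 2 + (c * (k%:R - a) ^+ 2 + c * (l%:R - b) ^+ 2).
  apply: (le_trans (MP _ _ z1 (disk_retract1 _))); rewrite lerD2l.
  have h : cabs (disk_retract (w k l) - z) ^+ 2 <= 4 * cabs (w k l - z) ^+ 2.
    have := disk_retract_dist (w k l) z1; have := cabs_ge0 (disk_retract (w k l) - z); nra.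
  apply: (le_trans (ler_wpM2l M0 h)).
  rewrite sqr_cabs.
  have -> : complex.Re (w k l - z) = (2 / n.+1%:R) * (k%:R - a).
    by rewrite raddfB /= /a /x; move: (n.+1%:R : R) N0 => N N0; field; rewrite gt_eqF.
  have -> : complex.Im (w k l - z) = (2 / n.+1%:R) * (l%:R - b).
    by rewrite raddfB /= /b /y; move: (n.+1%:R : R) N0 => N N0; field; rewrite gt_eqF.
  rewrite le_eqVlt; apply/orP; left; apply/eqP; rewrite /c.
  by move: (n.+1%:R : R) N0 a b => N N0 a b; field; rewrite gt_eqF.
have bb : bern x n.+1 (fun k => bern y n.+1 (fun l =>
    e / 2 + (c * (k%:R - a) ^+ 2 + c * (l%:R - b) ^+ 2))) =
    e / 2 + c * (n.+1%:R * (x * (1 - x))) + c * (n.+1%:R * (y * (1 - y))).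
  have var t u : bern t n.+1 (fun k => c * (k%:R - u) ^+ 2) =
      c * ((n.+1%:R * t - u) ^+ 2 + n.+1%:R * (t * (1 - t))).
    by rewrite (bernZ _ _ c (fun k => (k%:R - u) ^+ 2)) bern_var.
  rewrite (_ : (fun k => bern _ _ _) = (fun k => e / 2 + (c * (k%:R - a) ^+ 2 +
      c * (n.+1%:R * (y * (1 - y)))))); last first.
    apply/funext => k; rewrite (bernD _ _ (fun=> e / 2) (fun l => c * (k%:R - a) ^+ 2 + c * (l%:R - b) ^+ 2)).
    rewrite bern_cst (bernD _ _ (fun=> c * (k%:R - a) ^+ 2) (fun l => c * (l%:R - b) ^+ 2)).
    by rewrite bern_cst var /b subrr expr0n /= add0r.
  rewrite (bernD _ _ (fun=> e / 2) (fun k => c * (k%:R - a) ^+ 2 + c * (n.+1%:R * (y * (1 - y))))).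
  rewrite bern_cst (bernD _ _ (fun k => c * (k%:R - a) ^+ 2) (fun=> c * (n.+1%:R * (y * (1 - y))))).
  by rewrite bern_cst var /a subrr expr0n /= add0r addrA.
apply: (@le_trans _ _ (bern x n.+1 (fun k => bern y n.+1 (fun l =>
    e / 2 + (c * (k%:R - a) ^+ 2 + c * (l%:R - b) ^+ 2))))).
  apply: ler_bern => // k; apply: (le_trans (cabs_bern _ _ y01)).
  by apply: ler_bern => // l.
rewrite bb.
have c1 : c * n.+1%:R = 16 * M / n.+1%:R by rewrite /c; move: (n.+1%:R : R) N0 => N N0; field; rewrite gt_eqF.
have c2 : 16 * M / n.+1%:R <= e / 2.
  rewrite ler_pdivrMr //; move: nP; rewrite ltr_pdivrMr //; lra.
have c0 : 0 <= 16 * M / n.+1%:R by rewrite divr_ge0 ?mulr_ge0 // ltW.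
have xx : x * (1 - x) <= 2^-1 by nra.
have yy : y * (1 - y) <= 2^-1 by nra.
have cx := ler_wpM2l c0 xx; have cy := ler_wpM2l c0 yy.
rewrite [c * (_ * _)]mulrA [in X in _ + X <= _]mulrA c1. move: (x * (1 - x)) (y * (1 - y)) cx cy c2 => X Y. move: (16 * M / n.+1%:R) => C. lra.
Qed.

Lemma gauss_dense (R : realType) (c : R[i]) (e : R) : 0 < e ->
  exists k, cabs (c - gauss R k) <= e.
Proof.
move=> e0.
have [n nP] : exists n : nat, 2 / e < n.+1%:R.
  by exists (Num.truncn (2 / e)); exact: truncnS_gt.
have N0 : 0 < n.+1%:R :> R by rewrite ltr0n.
have zsplit (m : int) : exists a b : nat, m%:~R = a%:R - b%:R :> R[i].
  case: m => m; first by exists m, 0%N; rewrite subr0.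
  by exists 0%N, m.+1; rewrite sub0r NegzE mulrNz.
have [a [b ab]] := zsplit (Num.floor (n.+1%:R * complex.Re c)).
have [a' [b' ab']] := zsplit (Num.floor (n.+1%:R * complex.Im c)).
exists (CodeSeq.code [:: a; b; a'; b'; n]).
rewrite /gauss CodeSeq.codeK /= -ab -ab'.
have fl (x : R) : 0 <= x - (Num.floor (n.+1%:R * x))%:~R / n.+1%:R <= n.+1%:R^-1.
  have /andP[h1 h2] := floor_itv (n.+1%:R * x).
  move: h1 h2; rewrite intrD; move: ((Num.floor (n.+1%:R * x))%:~R : R) => F h1 h2.
  rewrite subr_ge0 lerBlDr -{2}[_^-1]mul1r -mulrDl ler_pdivrMr // ler_pdivlMr //.
  by apply/andP; split; lra.
have -> : c - ((Num.floor (n.+1%:R * complex.Re c))%:~R + 'i%C *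
   (Num.floor (n.+1%:R * complex.Im c))%:~R) / n.+1%:R =
  (complex.Re c - (Num.floor (n.+1%:R * complex.Re c))%:~R / n.+1%:R)%:C%C +
  'i%C * (complex.Im c - (Num.floor (n.+1%:R * complex.Im c))%:~R / n.+1%:R)%:C%C.
  rewrite {1}[c]complex_split !rmorphB !rmorphM !fmorphV /= !rmorph_nat !rmorph_int.
  ring.
apply: (le_trans (ler_cabsD _ _)); rewrite cabsM cabs_i mul1r !cabsR.
have /andP[r0 r1] := fl (complex.Re c); have /andP[i0 i1] := fl (complex.Im c).
rewrite !ger0_norm //.
apply: (le_trans (lerD r1 i1)); rewrite -mulr2n -[X in X <= _]mulr_natl.
by rewrite ler_pdivrMr // mulrC -ler_pdivrMr // ltW.
Qed.

Lemma ratpoly_dense (R : realType) (P : {poly {poly R[i]}}) (e : R) : 0 < e ->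
  exists n, forall z, cabs z <= 1 -> cabs (ev2 P z - ratpoly n z) <= e.
Proof.
move=> e0; pose S : nat := (\sum_(j < size P) size (P`_j)%R)%N.
have d0 : 0 < e / S.+1%:R by rewrite divr_gt0 // ltr0n.
have [gc gcP] := choice (fun c => gauss_dense c d0).
pose rows := [seq [seq gc c | c <- polyseq p] | p <- polyseq P].
exists (CodeSeq.code (map CodeSeq.code rows)) => z z1.
rewrite /ratpoly CodeSeq.codeK mapK; last exact: CodeSeq.codeK.
have -> : ev2 P z = \sum_(j < size P) \sum_(k < size P`_j) P`_j`_k * z ^+ j * z^* ^+ k.
  rewrite /ev2 [P.[_]]horner_coef horner_sum; apply: eq_bigr => j _.
  rewrite hornerM -rmorphXn hornerC /= horner_coef mulr_suml.
  by apply: eq_bigr => k _; ring.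
rewrite size_map -sumrB.
apply: (le_trans (cabs_sum _ _)).
apply: (@le_trans _ _ (\sum_(j < size P) (size P`_j)%:R * (e / S.+1%:R))).
  apply: ler_sum => j _.
  rewrite (nth_map 0) // size_map -sumrB.
  apply: (le_trans (cabs_sum _ _)).
  rewrite mulr_natl -[X in _ *+ X]card_ord -sumr_const.
  apply: ler_sum => k _.
  rewrite (nth_map 0) // -!mulrBl !cabsM !cabsX cabs_conj.
  apply: le_trans (gcP P`_j`_k); rewrite -mulrA.
  apply: ler_piMr; first exact: cabs_ge0.
  by rewrite mulr_ile1 ?exprn_ge0 ?exprn_ile1 ?cabs_ge0.
rewrite -mulr_suml -natr_sum -/S mulrCA.
apply: ler_piMr; first exact: ltW.
by rewrite ler_pdivrMr ?ltr0n // mul1r ler_nat.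
Qed.

Lemma disk_val (R : realType) (z : disk R) : cabs (set_val z) <= 1.
Proof. by case: z => z h; exact: (set_mem h). Qed.

Lemma cont_dense (R : realType) (f : continuousType (disk R) R[i]) (e : R) : 0 < e ->
  exists n, forall z : disk R, cabs (f z - ratpoly n (set_val z)) <= e.
Proof.
move=> e0; have e20 : 0 < e / 2 by rewrite divr_gt0.
pose fe (z : R[i]) : R[i] := if pselect (disk R z) is left h then f (SigSub (mem_set h)) else 0.
have feE (z : disk R) : fe (set_val z) = f z.
  rewrite /fe; case: pselect => [h|]; last by have := disk_val z.
  by congr (f _); apply: val_inj.
have [z z1 d d0|P PP] := @poly_dense R fe _ _ e20.
  pose zz : disk R := SigSub (mem_set (z1 : disk R z)).
  have d0' : 0 < d%:C%C :> R[i] by rewrite ltcR.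
  have := @cts_fun _ _ f zz; move=> /cvgrPdist_lt/(_ _ d0').
  rewrite /prop_near1 nbhsE => -[V [[B oB BO] Vzz] VP].
  have /nbhs_ballP[r /= r0 rB] : nbhs z B.
    by apply: open_nbhs_nbhs; split=> //; move: Vzz; rewrite -BO.
  have rE : r = (complex.Re r)%:C%C by rewrite -[LHS]RRe_real // ger0_real // ltW.
  exists (complex.Re r); first by rewrite -ltcR -rE.
  move=> w w1 wz; pose ww : disk R := SigSub (mem_set (w1 : disk R w)).
  have : V ww by rewrite -BO; apply: rB; rewrite -ball_normE /= cabsE rE ltcR cabs_distC.
  by move=> /VP /=; rewrite -(feE zz) -(feE ww) cabsE ltcR cabs_distC.
have [n nP] := ratpoly_dense P e20.
exists n => z; rewrite -feE; apply: (le_trans (ler_cabs_dist (ev2 P (set_val z)) _ _)).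
by have := PP _ (disk_val z); have := nP _ (disk_val z); lra.
Qed.

(** ** The represented space *)

Definition cont_names (R : realType) (p : baire)
    (f : continuousType (disk R) R[i]) : Prop :=
  forall n, (ereal_sup (range (fun z : disk R =>
    (cabs (f z - ratpoly (p n) (set_val z)))%:E)) < (2 ^- n)%:E)%E.

Lemma cont_names_fun (R : realType) (p : baire) (f g : continuousType (disk R) R[i]) :
  cont_names p f -> cont_names p g -> f = g.
Proof.
have le (h : continuousType (disk R) R[i]) n (z : disk R) : cont_names p h ->
    cabs (h z - ratpoly (p n) (set_val z)) <= 2 ^- n.
  move=> /(_ n)/ltW; rewrite -lee_fin; apply: le_trans.
  by apply: ereal_sup_ubound; exists z.
move=> pf pg; apply/continuousEP => z; apply/eqP; rewrite -subr_eq0; apply/eqP.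
apply: ComplexField.Normc.eq0_normc; rewrite -/(cabs _).
apply/eqP; rewrite eq_le cabs_ge0 andbT; apply/ler_addgt0Pl => e e0; rewrite addr0.
have [n nP] : exists n : nat, 2 / e < n.+1%:R.
  by exists (Num.truncn (2 / e)); exact: truncnS_gt.
apply: (le_trans (ler_cabs_dist (ratpoly (p n.+1) (set_val z)) _ _)).
rewrite [X in _ + X]cabs_distC.
apply: (le_trans (lerD (le f _ z pf) (le g _ z pg))).
rewrite -mulr2n -[X in X <= _]mulr_natl ler_pdivrMr ?exprn_gt0 // mulrC -ler_pdivrMr //.
apply: (le_trans (ltW nP)).
by rewrite -natrX ler_nat ltnW // ltn_expl.
Qed.

Lemma cont_names_surj (R : realType) (f : continuousType (disk R) R[i]) :
  exists p, cont_names p f.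
Proof.
have h n : exists k, (ereal_sup (range (fun z : disk R =>
    (cabs (f z - ratpoly k (set_val z)))%:E)) < (2 ^- n)%:E)%E.
  have e0 : 0 < 2 ^- n.+1 :> R by rewrite invr_gt0 exprn_gt0.
  have [k kP] := cont_dense f e0; exists k.
  apply: (@le_lt_trans _ _ (2 ^- n.+1)%:E).
    by apply: ge_ereal_sup => _ [z _ <-]; rewrite lee_fin.
  by rewrite lte_fin ltf_pV2 ?posrE ?exprn_gt0 // ltr_eXn2l // ltr1n.
by have [p pP] := choice h; exists p.
Qed.

Definition cont_space (R : realType) : rep_space :=
  RepSpace (@cont_names_fun R) (@cont_names_surj R).

(** * The three problems on restrictions of polynomials *)

Definition restricts (R : realType) (P : {poly R[i]}) (f : cont_space R) : Prop :=
  forall z : disk R, f z = P.[set_val z].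

Definition poly_restriction (R : realType) : set (cont_space R) :=
  [set f | exists P, restricts P f].

(** The zero polynomial gets degree 0. *)
Definition poly_deg (R : realType) (P : {poly R[i]}) : nat := (size P).-1.

Definition deg_problem (R : realType) : problem (cont_space R) nat_space :=
  @Problem (cont_space R) nat_space (@poly_restriction R)
    (fun f => [set n | exists P, restricts P f /\ n = poly_deg P]).

Definition dbnd_problem (R : realType) : problem (cont_space R) nat_space :=
  @Problem (cont_space R) nat_space (@poly_restriction R)
    (fun f => [set n | exists P, restricts P f /\ (poly_deg P <= n)%N]).

Definition analytic_at (R : realType) (g : R[i] -> R[i]) (z0 : R[i]) : Prop :=
  exists (a : nat -> R[i]) (r : R), 0 < r /\
    forall z, cabs (z - z0) < r ->
      series (fun n => a n * (z - z0) ^+ n) @ \oo --> g z.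

Definition adv_disk (R : realType) (m : nat) : set R[i] :=
  [set z | cabs z < 2 `^ m.+1%:R^-1].
Arguments adv_disk : clear implicits.

(** Being analytic on a closed set means being analytic on some open
    neighbourhood of it. *)
Definition adv_problem (R : realType) : problem (cont_space R) nat_space :=
  @Problem (cont_space R) nat_space (@poly_restriction R)
    (fun f => [set m | exists (V : set R[i]) (g : R[i] -> R[i]),
      [/\ open V, closure (adv_disk R m) `<=` V,
          forall z, V z -> analytic_at g z,
          forall z : disk R, g (set_val z) = f z &
          forall z, closure (adv_disk R m) z -> cabs (g z) <= m%:R]]).

(* Main.v *)
Require Import Defs.
From HB Require Import structures.
From mathcomp Require Import all_boot all_order all_algebra.
From mathcomp Require Import cyclic separable cyclotomic.
From mathcomp Require Import all_classical all_reals all_analysis.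
From mathcomp Require Import complex.
From mathcomp Require Import zify ring lra.

(** Averaging over roots of unity expresses the coefficient [a_l] of a polynomial
    as a functional of norm at most 1 that is computable exactly on the rational
    polynomials in [z] and [z^*]; hence [a_l <> 0] is semidecidable from a name of
    the restriction, say by tests [T(l, m)] for [m] in [nat].  The pairs [(n, m)]
    such that [n = 0] or [T(n, m)] holds, while [T(l, k)] fails for all [l > n] and
    all [k], then form a nonempty co-enumerable set, and [n] is the degree in each
    of them.  The degree and a bound on the sup norm over the disk also bound the
    polynomial on [|z| <= 2], which solves the third problem.

    Conversely, let [A] be given by an enumeration of its complement, and let a
    guess for an element of [A] be increased at stage [s] whenever it is found to
    lie outside [A].  This happens finitely often, so the sum of
    [2 ^- s.+1 * z ^ e_s] over the stages [s] of a change is a polynomial, of which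
    a name is computable.  With [e_s = (s + 2) * (2 * s + 2)], no change can occur
    at a stage [s >= y] if [y] bounds the degree, or if [y] bounds the values of the
    polynomial on the disk of radius [2 ^ (1 / (y + 1))], because at
    [t = 2 ^ (1 / (y + 2))] a change at [s >= y] contributes more than [s]. *)

Set Implicit Arguments.
Unset Strict Implicit.
Unset Printing Implicit Defensive.

(** * Primitive recursive functions with an oracle *)

Inductive expr : Type :=
| EVar of nat
| ECst of nat
| EAdd of expr & expr
| ESub of expr & expr
| EMul of expr & expr
| EQuery of expr
| ESum of expr & expr
| ERec of expr & expr & expr
| EApp of expr & seq expr.

(** Variables are de Bruijn indices: [ESum n f] binds the summation index in
    [f], and [ERec n a b] binds in [b] the step and the previous value. *)
Fixpoint denote (p : baire) (xs : seq nat) (e : expr) {struct e} : nat :=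
  match e with
  | EVar i => nth 0 xs i
  | ECst n => n
  | EAdd a b => denote p xs a + denote p xs b
  | ESub a b => denote p xs a - denote p xs b
  | EMul a b => denote p xs a * denote p xs b
  | EQuery a => p (denote p xs a)
  | ESum n f => \sum_(i < denote p xs n) denote p (val i :: xs) f
  | ERec n a b => nat_rec (fun=> nat) (denote p xs a)
      (fun i y => denote p [:: i, y & xs] b) (denote p xs n)
  | EApp f es => denote p [seq denote p xs a | a <- es] f
  end.

Definition oadd := ORec (OProj 0) (OComp OSucc [:: OProj 1]).
Definition opred := OComp (ORec OZero (OProj 0)) [:: OProj 0; OProj 0].
(** Recursion runs on the first argument, so the subtrahend is moved to the front. *)
Definition osub := OComp (ORec (OProj 0) (OComp opred [:: OProj 1]))
  [:: OProj 1; OProj 0].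
Definition omul := ORec OZero (OComp oadd [:: OProj 2; OProj 1]).

Fixpoint ocst n := if n is m.+1 then OComp OSucc [:: ocst m] else OZero.

(** [k] is the length of the environment: [OComp] replaces the whole argument list, so the variables
    are passed on by explicit projections. Under [ESum] they start at position 2, behind the index
    and the accumulator, and the latter is hidden from the summand. *)
Fixpoint compile (k : nat) (e : expr) {struct e} : oprog :=
  match e with
  | EVar i => OProj i
  | ECst n => ocst n
  | EAdd a b => OComp oadd [:: compile k a; compile k b]
  | ESub a b => OComp osub [:: compile k a; compile k b]
  | EMul a b => OComp omul [:: compile k a; compile k b]
  | EQuery a => OComp OQuery [:: compile k a]
  | ESum n f => OComp (ORec OZero (OComp oadd [:: OProj 1;
        OComp (compile k.+1 f) (OProj 0 :: map OProj (iota 2 k))]))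
      (compile k n :: map OProj (iota 0 k))
  | ERec n a b => OComp (ORec (compile k a) (compile k.+2 b))
      (compile k n :: map OProj (iota 0 k))
  | EApp f es => OComp (compile (size es) f) (map (compile k) es)
  end.

Section Correctness.
Variable p : baire.

Lemma oeval_comp1 f g xs x y :
  oeval p g xs x -> oeval p f [:: x] y -> oeval p (OComp f [:: g]) xs y.
Proof. by move=> gx fy; apply: (@oeval_comp _ _ _ _ [:: x]) => // -[]. Qed.

Lemma oeval_comp2 f g h xs x1 x2 y :
  oeval p g xs x1 -> oeval p h xs x2 -> oeval p f [:: x1; x2] y ->
  oeval p (OComp f [:: g; h]) xs y.
Proof.
by move=> gx hx fy; apply: (@oeval_comp _ _ _ _ [:: x1; x2]) => // -[|[]].
Qed.

Lemma oeval_oadd a b : oeval p oadd [:: a; b] (a + b).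
Proof.
elim: a => [|a IH]; first by apply: oeval_rec0; apply: (@oeval_proj _ 0 [:: b]).
apply: oeval_recS IH _; apply: oeval_comp1; last exact: (@oeval_succ _ [:: _]).
exact: (@oeval_proj _ 1 [:: a; a + b; b]).
Qed.

Lemma oeval_opred a xs : oeval p opred (a :: xs) a.-1.
Proof.
apply: oeval_comp2; [exact: (@oeval_proj _ 0)|exact: (@oeval_proj _ 0)|] => /=.
elim: {1 3}a => [|n IH]; first by apply: oeval_rec0; apply: oeval_zero.
by apply: oeval_recS IH _; apply: (@oeval_proj _ 0).
Qed.

Lemma oeval_osub a b : oeval p osub [:: a; b] (a - b).
Proof.
apply: oeval_comp2; [exact: (@oeval_proj _ 1)|exact: (@oeval_proj _ 0)|] => /=.
elim: b => [|b IH].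
  by rewrite subn0; apply: oeval_rec0; apply: (@oeval_proj _ 0 [:: a]).
apply: oeval_recS IH _; rewrite subnS; apply: oeval_comp1 (oeval_opred _ _).
exact: (@oeval_proj _ 1 [:: b; a - b; a]).
Qed.

Lemma oeval_omul a b : oeval p omul [:: a; b] (a * b).
Proof.
elim: a => [|a IH]; first by apply: oeval_rec0; apply: oeval_zero.
apply: oeval_recS IH _; rewrite mulSn; apply: oeval_comp2 (oeval_oadd _ _).
  exact: (@oeval_proj _ 2 [:: a; a * b; b]).
exact: (@oeval_proj _ 1 [:: a; a * b; b]).
Qed.

Lemma oeval_ocst n xs : oeval p (ocst n) xs n.
Proof.
elim: n => [|n IH]; first exact: oeval_zero.
by apply: oeval_comp1 IH _; apply: (@oeval_succ _ [:: n]).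
Qed.

Lemma oeval_comp_env f g xs ys m k x y :
  size ys = k -> (forall i, (i < k)%N -> nth 0 xs (m + i) = nth 0 ys i) ->
  oeval p g xs x -> oeval p f (x :: ys) y ->
  oeval p (OComp f (g :: map OProj (iota m k))) xs y.
Proof.
move=> sz eq_xs gx fy; apply: oeval_comp fy => /=.
  by rewrite size_map size_iota sz.
rewrite size_map size_iota => -[|i] //= ik.
by rewrite (nth_map 0) ?size_iota// nth_iota// -eq_xs//; apply: oeval_proj.
Qed.

Lemma compileP : forall e k xs, size xs = k -> oeval p (compile k e) xs (denote p xs e).
Proof.
(* The arguments of [EApp] are nested in a list, where the generated induction principle gives no
   hypothesis. *)
fix IH 1; case=> [i|n|a b|a b|a b|a|n f|n a b|f es] k xs sz /=.
- exact: oeval_proj.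
- exact: oeval_ocst.
- by apply: oeval_comp2 (oeval_oadd _ _); apply: IH.
- by apply: oeval_comp2 (oeval_osub _ _); apply: IH.
- by apply: oeval_comp2 (oeval_omul _ _); apply: IH.
- by apply: oeval_comp1; [apply: IH|apply: (@oeval_query _ [:: _])].
- apply: (oeval_comp_env sz) => //; first exact: IH.
  elim: (denote p xs n) => [|m IHm].
    by rewrite big_ord0; apply: oeval_rec0; apply: oeval_zero.
  apply: oeval_recS IHm _; rewrite big_ord_recr /=.
  apply: oeval_comp2 (oeval_oadd _ _); first exact: (@oeval_proj _ 1 [:: m, _ & xs]).
  apply: (oeval_comp_env sz) => //; first exact: (@oeval_proj _ 0 [:: m, _ & xs]).
  by apply: IH; rewrite /= sz.
- apply: (oeval_comp_env sz) => //; first exact: IH.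
  elim: (denote p xs n) => [|m IHm] /=; first by apply: oeval_rec0; apply: IH.
  by apply: oeval_recS IHm _; apply: IH; rewrite /= sz.
- apply: (@oeval_comp _ _ _ _ [seq denote p xs a | a <- es]); last first.
  + by apply: IH; rewrite size_map.
  + elim: es => [|a es IHes] [|i] //= ies; first exact: IH.
    by apply: IHes.
  + by rewrite !size_map.
Qed.

End Correctness.

(** Compilation turns both expressions into programs. They denote total functions, so only names of
    points of the domain matter, and there every realizer of [g] returns a correct answer. *)
Lemma weihrauch_le_eval (X Y Z W : rep_space) (f : problem X Y) (g : problem Z W)
    (eH eK : expr) :
  (forall p x, names p x -> dom f x ->
    exists z, [/\ names (fun n => denote p [:: n] eH) z, dom g z &
      forall q w, names q w -> sol g z w ->
        exists2 y, names (fun n => denote (baire_join p q) [:: n] eK) y & sol f x y]) ->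
  weihrauch_le f g.
Proof.
move=> fg; exists (fun p => Some (fun n => denote p [:: n] eH)).
exists (fun p q => Some (fun n => denote (baire_join p q) [:: n] eK)); split.
- by exists (compile 1 eH) => p _ [<-] n; apply: compileP.
- by exists (compile 1 eK) => p q _ [<-] n; apply: compileP.
- move=> G Gg p x px fx; have [z [pz gz K]] := fg p x px fx.
  have [q [w [Gq qw gw]]] := Gg _ _ pz gz.
  have [y Ky fy] := K q w qw gw.
  by exists (fun n => denote (baire_join p q) [:: n] eK), y; rewrite /= Gq.
Qed.

Arguments denote : simpl never.

Section EvalTheory.
Variables (p : baire) (xs : seq nat).

Lemma eval_var i : denote p xs (EVar i) = nth 0 xs i. Proof. by []. Qed.
Lemma eval_cst n : denote p xs (ECst n) = n. Proof. by []. Qed.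
Lemma eval_add a b : denote p xs (EAdd a b) = denote p xs a + denote p xs b.
Proof. by []. Qed.
Lemma eval_sub a b : denote p xs (ESub a b) = denote p xs a - denote p xs b.
Proof. by []. Qed.
Lemma eval_mul a b : denote p xs (EMul a b) = denote p xs a * denote p xs b.
Proof. by []. Qed.
Lemma eval_query a : denote p xs (EQuery a) = p (denote p xs a). Proof. by []. Qed.
Lemma eval_sum n f :
  denote p xs (ESum n f) = \sum_(i < denote p xs n) denote p (val i :: xs) f.
Proof. by []. Qed.
Lemma eval_rec n a b : denote p xs (ERec n a b) =
  nat_rec (fun=> nat) (denote p xs a) (fun i y => denote p [:: i, y & xs] b) (denote p xs n).
Proof. by []. Qed.
Lemma eval_app f es : denote p xs (EApp f es) = denote p [seq denote p xs a | a <- es] f.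
Proof. by []. Qed.

End EvalTheory.

(** * Derived arithmetic and list operations *)

Definition ESucc a := EAdd a (ECst 1).
(** Truth values are 0 and 1, and truncated subtraction from 1 is negation. *)
Definition EEq a b := ESub (ECst 1) (EAdd (ESub a b) (ESub b a)).
Definition ELt a b := ESub (ECst 1) (ESub (ESucc a) b).
Definition EPow2 a := ERec a (ECst 1) (EAdd (EVar 1) (EVar 1)).
(** [CodeSeq.code] sends the empty list to 0 and [a :: s] to [2 ^ a * (2 * code s + 1)]. *)
Definition ECons a b := EMul (EPow2 a) (ESucc (EMul (ECst 2) b)).

Section DerivedEval.
Variables (p : baire) (xs : seq nat).

Lemma eval_succ a : denote p xs (ESucc a) = (denote p xs a).+1.
Proof. exact: addn1. Qed.

Lemma eval_eq a b : denote p xs (EEq a b) = (denote p xs a == denote p xs b).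
Proof. by rewrite /EEq !(eval_sub, eval_add, eval_cst); case: eqP; lia. Qed.

Lemma eval_lt a b : denote p xs (ELt a b) = (denote p xs a < denote p xs b).
Proof. by rewrite /ELt !(eval_sub, eval_succ, eval_cst); case: ltnP; lia. Qed.

Lemma eval_pow2 a : denote p xs (EPow2 a) = 2 ^ denote p xs a.
Proof.
rewrite /EPow2 eval_rec; elim: (denote p xs a) => //= n ->.
by rewrite eval_add !eval_var /= expnS mul2n addnn.
Qed.

Lemma eval_cons a b s : denote p xs b = CodeSeq.code s ->
  denote p xs (ECons a b) = CodeSeq.code (denote p xs a :: s).
Proof.
by rewrite /ECons eval_mul eval_pow2 eval_succ eval_mul eval_cst => ->; rewrite /= mul2n.
Qed.

End DerivedEval.

Definition evalE := (eval_succ, eval_eq, eval_lt, eval_pow2, eval_var, eval_cst,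
  eval_add, eval_sub, eval_mul, eval_query, eval_sum, eval_app).

(** * Decoding lists of numbers *)

Definition cnth (c k : nat) : nat := nth 0 (CodeSeq.decode c) k.

Lemma cnth_code s k : cnth (CodeSeq.code s) k = nth 0 s k.
Proof. by rewrite /cnth CodeSeq.codeK. Qed.

Lemma cnth_oversize c k : size (CodeSeq.decode c) <= k -> cnth c k = 0.
Proof. exact: nth_default. Qed.

(** A code dominates its entries, and its length by [size_decode]; sums over entries may therefore
    run up to the code itself. *)
Lemma cnth_le c k : cnth c k <= c.
Proof.
rewrite /cnth; have [kc|kc] := ltnP k (size (CodeSeq.decode c)); last by rewrite nth_default.
exact: ltnW (allP (CodeSeq.gtn_decode c) _ (mem_nth 0 kc)).
Qed.

Lemma size_decode c : size (CodeSeq.decode c) <= c.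
Proof.
rewrite -{2}[c]CodeSeq.decodeK; elim: (CodeSeq.decode c) => //= n s IH.
have : 0 < 2 ^ n by rewrite expn_gt0.
nia.
Qed.

Lemma sum_nat_single (n i : nat) (F : nat -> nat) : i < n ->
  (forall j, j != i -> F j = 0) -> \sum_(j < n) F j = F i.
Proof.
move=> ni F0; rewrite (bigD1 (Ordinal ni)) //= big1 ?addn0// => j ji.
by rewrite F0.
Qed.

(** The head [h] and tail [t] of a code [c > 0] are the only solution of
    [c = 2 ^ h * (2 * t + 1)]. *)
Lemma sum_decode c (F : nat -> nat -> nat) :
  \sum_(h < c.+1) \sum_(t < c.+1) (c == 2 ^ h * t.*2.+1) * F h t =
  if CodeSeq.decode c is h :: s then F h (CodeSeq.code s) else 0.
Proof.
have E h t : c == 2 ^ h * t.*2.+1 -> CodeSeq.decode c = h :: CodeSeq.decode t.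
  move=> /eqP cE; apply: (can_inj CodeSeq.codeK).
  by rewrite CodeSeq.decodeK /= CodeSeq.decodeK.
case D: (CodeSeq.decode c) => [|h s].
  by rewrite big1// => h _; rewrite big1// => t _; case: eqP => // /eqP /E; rewrite D.
have cE : c = 2 ^ h * (CodeSeq.code s).*2.+1 by rewrite -[c]CodeSeq.decodeK D.
have hc : h < c.+1.
  by rewrite ltnS; have := cnth_le c 0; rewrite /cnth D.
have sc : CodeSeq.code s < c.+1.
  have : 0 < 2 ^ h by rewrite expn_gt0.
  by rewrite cE; move: (CodeSeq.code s) => x; nia.
rewrite (sum_nat_single hc (F := fun h => \sum_(t < c.+1) (c == 2 ^ h * t.*2.+1) * F h t)).
  rewrite (sum_nat_single sc (F := fun t => (c == 2 ^ h * t.*2.+1) * F h t)).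
    by rewrite -cE eqxx mul1n.
  move=> t ts; case: eqP => // /eqP /E; rewrite D => -[sE].
  by move: ts; rewrite sE CodeSeq.decodeK eqxx.
move=> h' hh; rewrite big1// => t _; case: eqP => // /eqP /E; rewrite D => -[hE].
by rewrite hE eqxx in hh.
Qed.

(** The bounded double sum of [sum_decode] replaces a search for head and tail. *)
Lemma decode_prog f : {e | forall p c, denote p [:: c] e =
  if CodeSeq.decode c is h :: s then denote p [:: CodeSeq.code s; h; c] f else 0}.
Proof.
exists (ESum (ESucc (EVar 0)) (ESum (ESucc (EVar 1))
  (EMul (EEq (EVar 2) (ECons (EVar 1) (EVar 0))) f))) => p c.
rewrite -(sum_decode c (fun h t => denote p [:: t; h; c] f)) !evalE /=.
apply: eq_bigr => h _; rewrite !evalE /=; apply: eq_bigr => t _.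
by rewrite !evalE /= mul2n.
Qed.

(** Take the tail [k] times, then the head; on the empty list both give 0, the default value of
    [cnth]. *)
Lemma nth_prog : {e | forall p c k, denote p [:: c; k] e = cnth c k}.
Proof.
exists (EApp (sval (decode_prog (EVar 1)))
  [:: ERec (EVar 1) (EVar 0) (EApp (sval (decode_prog (EVar 0))) [:: EVar 1])]) => p c n.
rewrite eval_app /= eval_rec !eval_var /= /cnth.
have -> : nat_rec (fun=> nat) c (fun i y => denote p [:: i; y; c; n]
    (EApp (sval (decode_prog (EVar 0))) [:: EVar 1])) n =
    CodeSeq.code (drop n (CodeSeq.decode c)).
  elim: n => [|n /= ->]; first by rewrite /= drop0 CodeSeq.decodeK.
  rewrite eval_app /= eval_var /= (svalP (decode_prog _)) CodeSeq.codeK.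
  rewrite -addn1 addnC -drop_drop.
  by case: (drop n _) => //= h s; rewrite eval_var /= drop0.
rewrite (svalP (decode_prog _)) CodeSeq.codeK -[n in RHS]addn0 -nth_drop.
by case: (drop n _).
Qed.

Definition ENth a k := EApp (sval nth_prog) [:: a; k].

Lemma eval_nth p xs a k :
  denote p xs (ENth a k) = cnth (denote p xs a) (denote p xs k).
Proof. by rewrite /ENth eval_app /= (svalP nth_prog). Qed.

(** * Programs testing coefficients and coding polynomials *)

Section Diagonal.
Variables c l : nat.

(** The code of the coefficient of [z ^+ (k + l) * z^* ^+ k], a monomial that equals [z ^+ l] on the
    unit circle. *)
Definition diag (k : nat) : nat := cnth (cnth c (k + l)) k.

(** [cnum i n / cden n] is the sum over [k < n] of the [i]-th components of the
    coefficients [diag k], divided by their denominators. *)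
Fixpoint cden (n : nat) : nat := if n is m.+1 then cden m * (cnth (diag m) 4).+1 else 1.

Fixpoint cnum (i n : nat) : nat :=
  if n is m.+1 then cnum i m * (cnth (diag m) 4).+1 + cnth (diag m) i * cden m else 0.

(** A comparison of fractions with denominators cleared; the two truncated differences add up to an
    absolute value. Stopping at [k = c] loses nothing, because a code dominates the lengths of its
    rows. *)
Definition exceeds (m i j : nat) : bool :=
  cden c < ((cnum i c - cnum j c) + (cnum j c - cnum i c)) * 2 ^ m.

End Diagonal.

(** Components 0 and 1 give the real part and 2 and 3 the imaginary part. The threshold is the error
    of the [m]-th approximation, so a success is conclusive. *)
Definition nonzero_at (p : baire) (l m : nat) : bool :=
  exceeds (p m) l m 0 1 || exceeds (p m) l m 2 3.

Lemma diag_prog : {e | forall p c l k, denote p [:: c; l; k] e = diag c l k}.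
Proof.
exists (ENth (ENth (EVar 0) (EAdd (EVar 2) (EVar 1))) (EVar 2)) => p c l k.
by rewrite !(eval_nth, evalE).
Qed.

Lemma den_prog : {e | forall p c l n, denote p [:: c; l; n] e = cden c l n}.
Proof.
exists (ERec (EVar 2) (ECst 1) (EMul (EVar 1) (ESucc (ENth
  (EApp (sval diag_prog) [:: EVar 2; EVar 3; EVar 0]) (ECst 4))))) => p c l n.
rewrite eval_rec !evalE /=; elim: {2 3}n => //= k ->.
by rewrite !(eval_nth, evalE) /= !evalE /= (svalP diag_prog).
Qed.

Lemma num_prog : {e | forall p c l i n, denote p [:: c; l; i; n] e = cnum c l i n}.
Proof.
pose d := EApp (sval diag_prog) [:: EVar 2; EVar 3; EVar 0].
exists (ERec (EVar 3) (ECst 0) (EAdd (EMul (EVar 1) (ESucc (ENth d (ECst 4))))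
  (EMul (ENth d (EVar 4)) (EApp (sval den_prog) [:: EVar 2; EVar 3; EVar 0]))))
  => p c l i n.
rewrite eval_rec !evalE /=; elim: {2 3}n => //= k ->.
by rewrite !(eval_nth, evalE) /= !evalE /= (svalP diag_prog) (svalP den_prog).
Qed.

Lemma exceeds_prog :
  {e | forall p c l m i j, denote p [:: c; l; m; i; j] e = exceeds c l m i j}.
Proof.
pose num i := EApp (sval num_prog) [:: EVar 0; EVar 1; EVar i; EVar 0].
exists (ELt (EApp (sval den_prog) [:: EVar 0; EVar 1; EVar 0])
  (EMul (EAdd (ESub (num 3) (num 4)) (ESub (num 4) (num 3))) (EPow2 (EVar 2))))
  => p c l m i j.
by rewrite !evalE /= !evalE /= !(svalP num_prog) (svalP den_prog).
Qed.

Lemma nonzero_prog : {e | forall p l m, denote p [:: l; m] e = nonzero_at p l m}.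
Proof.
pose ex i j := EApp (sval exceeds_prog)
  [:: EQuery (EVar 1); EVar 0; EVar 1; ECst i; ECst j].
exists (ELt (ECst 0) (EAdd (ex 0 1) (ex 2 3))) => p l m.
rewrite !evalE /= !evalE /= !(svalP exceeds_prog) /nonzero_at.
by do 2 case: exceeds.
Qed.

(** [w] codes a candidate degree and a witness that its coefficient is nonzero; [l] and [m] are
    evidence for a larger degree. Candidate 0 passes the first test with any witness, which admits
    the zero polynomial. *)
Definition refuted (p : baire) (w l m : nat) : bool :=
  (0 < cnth w 0) && ~~ nonzero_at p (cnth w 0) (cnth w 1) ||
  (cnth w 0 < l) && nonzero_at p l m.

(** [t] runs over codes of triples; a refuted [w] is output as [w.+1], and 0 enumerates nothing, as
    in [closed_names]. *)
Lemma degree_input_prog : {e | forall p t, denote p [:: t] e =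
  refuted p (cnth t 0) (cnth t 1) (cnth t 2) * (cnth t 0).+1}.
Proof.
pose nth i := ENth (EVar 0) (ECst i).
pose nz a b := EApp (sval nonzero_prog) [:: a; b].
exists (EMul (ELt (ECst 0) (EAdd
    (EMul (ELt (ECst 0) (ENth (nth 0) (ECst 0)))
       (ESub (ECst 1) (nz (ENth (nth 0) (ECst 0)) (ENth (nth 0) (ECst 1)))))
    (EMul (ELt (ENth (nth 0) (ECst 0)) (nth 1)) (nz (nth 1) (nth 2)))))
  (ESucc (nth 0))) => p t.
rewrite !(eval_nth, evalE) /= !(eval_nth, evalE) /= !(svalP nonzero_prog).
rewrite /refuted; congr (_ * _); set w := cnth t 0.
by case: (0 < cnth w 0); case: (cnth w 0 < _); do 2 case: nonzero_at.
Qed.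

(** Position 1 of [baire_join p q] holds [q 0]. *)
Lemma degree_output_prog : {e | forall p q n,
  denote (baire_join p q) [:: n] e = cnth (q 0) 0}.
Proof.
by exists (ENth (EQuery (ECst 1)) (ECst 0)) => p q n; rewrite eval_nth !evalE.
Qed.

Lemma bound_output_prog : {e | forall p q n, denote (baire_join p q) [:: n] e =
  2 ^ (cnth (q 0) 0).+1 * (4 * p 0 ^ 2).+1}.
Proof.
pose x := EQuery (ECst 0).
exists (EMul (EPow2 (ESucc (ENth (EQuery (ECst 1)) (ECst 0))))
  (ESucc (EMul (ECst 4) (EMul x x)))) => p q n.
by rewrite !(eval_nth, evalE).
Qed.

(** * Guesses and the polynomials coding their changes *)

Fixpoint guess (p : baire) (s : nat) : nat :=
  if s is r.+1 then guess p r + (0 < \sum_(i < r) (p i == (guess p r).+1)) else 0.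

(** An entry [v.+1] excludes [v], and the first [s] entries are known at stage [s]. The increment in
    [guess] is this same test. *)
Definition changes (p : baire) (s : nat) : bool :=
  0 < \sum_(i < s) (p i == (guess p s).+1).

(** Factor 1 reads [p] itself; factor 2 reads [p] from the even positions of [baire_join p q]. *)
Lemma guess_prog f : {e | forall p s, denote p [:: s] e = guess (fun i => p (f * i)) s}.
Proof.
exists (ERec (EVar 0) (ECst 0) (EAdd (EVar 1) (ELt (ECst 0) (ESum (EVar 0)
  (EEq (EQuery (EMul (ECst f) (EVar 0))) (ESucc (EVar 2))))))) => p s.
rewrite eval_rec !evalE /=; elim: {2 3}s => //= r ->; rewrite !evalE /=.
by congr (_ + (0 < _)); apply: eq_bigr => i _; rewrite !evalE.
Qed.

Lemma changes_prog : {e | forall p s, denote p [:: s] e = changes p s}.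
Proof.
exists (ELt (ECst 0) (ESum (EVar 0)
  (EEq (EQuery (EVar 0)) (ESucc (EApp (sval (guess_prog 1)) [:: EVar 1]))))) => p s.
rewrite !evalE /= /changes; congr (nat_of_bool (0 < _)).
apply: eq_bigr => i _; rewrite !evalE /= (svalP (guess_prog 1)).
by have -> : (fun i => p (1 * i)) = p by apply/funext => j; rewrite mul1n.
Qed.

Lemma guess_output_prog : {e | forall p q n,
  denote (baire_join p q) [:: n] e = guess p (q 0)}.
Proof.
exists (EApp (sval (guess_prog 2)) [:: EQuery (ECst 1)]) => p q n.
rewrite !evalE /= (svalP (guess_prog 2)) !evalE; congr guess.
by apply/funext => i; rewrite /baire_join mul2n odd_double doubleK.
Qed.

Definition expo (s : nat) : nat := s.+2 * s.+1.*2.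

(** The code of the coefficient [2 ^- s.+1]. *)
Definition coefcode (s : nat) : nat := CodeSeq.code [:: 1; 0; 0; 0; (2 ^ s.+1).-1].

(** At most one [s] has exponent [j], and it is smaller than [j]; otherwise the sum is 0, which
    codes the coefficient 0. *)
Definition rowcode (p : baire) (j : nat) : nat :=
  \sum_(s < j.+1) (expo s == j) * (changes p s * coefcode s).

(** Rows have one entry because no power of [z^*] occurs. Exponents below [expo n.+1] belong to the
    stages up to [n]. *)
Definition polycode (p : baire) (n : nat) : nat :=
  CodeSeq.code [seq CodeSeq.code [:: rowcode p j] | j <- iota 0 (expo n.+1)].

Definition EExpo a := EMul (ESucc (ESucc a)) (EMul (ECst 2) (ESucc a)).

Lemma eval_expo p xs a : denote p xs (EExpo a) = expo (denote p xs a).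
Proof. by rewrite /EExpo !evalE /expo mul2n. Qed.

Lemma coef_prog : {e | forall p s, denote p [:: s] e = coefcode s}.
Proof.
exists (ECons (ECst 1) (ECons (ECst 0) (ECons (ECst 0) (ECons (ECst 0)
  (ECons (ESub (EPow2 (ESucc (EVar 0))) (ECst 1)) (ECst 0)))))) => p s.
rewrite (eval_cons _ (s := [:: 0; 0; 0; (2 ^ s.+1).-1])) ?eval_cst//.
rewrite (eval_cons _ (s := [:: 0; 0; (2 ^ s.+1).-1])) ?eval_cst//.
rewrite (eval_cons _ (s := [:: 0; (2 ^ s.+1).-1])) ?eval_cst//.
rewrite (eval_cons _ (s := [:: (2 ^ s.+1).-1])) ?eval_cst//.
by rewrite (eval_cons _ (s := [::])) ?eval_cst// !evalE subn1.
Qed.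

Lemma row_prog : {e | forall p j, denote p [:: j] e = CodeSeq.code [:: rowcode p j]}.
Proof.
exists (ECons (ESum (ESucc (EVar 0)) (EMul (EEq (EExpo (EVar 0)) (EVar 1))
  (EMul (EApp (sval changes_prog) [:: EVar 0]) (EApp (sval coef_prog) [:: EVar 0]))))
  (ECst 0)) => p j.
rewrite (eval_cons _ (s := [::])) ?eval_cst//; congr (CodeSeq.code [:: _]).
rewrite !evalE /=; apply: eq_bigr => s _.
by rewrite !(eval_expo, evalE) /= (svalP changes_prog) (svalP coef_prog).
Qed.

Lemma poly_input_prog : {e | forall p n, denote p [:: n] e = polycode p n}.
Proof.
exists (ERec (EExpo (ESucc (EVar 0))) (ECst 0) (ECons (EApp (sval row_prog)
  [:: ESub (EExpo (ESucc (EVar 2))) (ESucc (EVar 0))]) (EVar 1))) => p n.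
rewrite eval_rec eval_expo !evalE /polycode [nth _ _ _]/=.
(* The list grows at the front: after [k] steps it holds the last [k] rows, starting at row
   [N - k]. *)
set N := expo _; rewrite -[in iota 0](subnn N).
have : N <= N by [].
elim: {1 3 5 6}N => [//|k IH] kN /=; rewrite (IH (ltnW kN)).
rewrite (eval_cons _ (s := [seq CodeSeq.code [:: rowcode p j] | j <- iota (N - k) k])).
  by rewrite eval_app /= eval_sub eval_expo !evalE /= -/N (svalP row_prog) subnSK.
by rewrite eval_var.
Qed.

Import Order.TTheory GRing.Theory Num.Theory.
Import numFieldNormedType.Exports.
Local Open Scope classical_set_scope.
Local Open Scope ring_scope.

(** * Coefficients of polynomials from names of their restrictions *)

(** ['X^n - 1] splits and is separable, so there are [n] distinct roots of unity, and among these is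
    a primitive one. *)
Lemma closed_prim_root (F : numClosedFieldType) (n : nat) : (0 < n)%N ->
  exists z : F, n.-primitive_root z.
Proof.
move=> n0; pose p : {poly F} := 'X^n - 1; have [r Dp] := closed_field_poly_normal p.
rewrite (monicP _) ?monicXnsubC // scale1r in Dp.
have rn1 : all n.-unity_root r by apply/allP => z; rewrite -root_prod_XsubC -Dp.
have sz_r : (n < (size r).+1)%N.
  by rewrite -(size_prod_XsubC r id) -Dp size_XnsubC.
have [|z] := hasP (has_prim_root n0 rn1 _ sz_r); last by exists z.
by rewrite -separable_prod_XsubC -Dp separable_Xn_sub_1// pnatr_eq0 -lt0n.
Qed.

Lemma sum_unity (F : fieldType) (n : nat) (u : F) : u ^+ n = 1 ->
  \sum_(t < n) u ^+ t = if u == 1 then n%:R else 0.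
Proof.
move=> un; case: eqVneq => [->|u1].
  by under eq_bigr do rewrite expr1n; rewrite sumr_const card_ord.
apply: (mulfI (_ : u - 1 != 0)); first by rewrite subr_eq0.
by rewrite -subrX1 un subrr mulr0.
Qed.

Lemma cabs_unit (R : realType) (n : nat) (w : R[i]) : (0 < n)%N -> w ^+ n = 1 -> cabs w = 1.
Proof.
move=> n0 wn; apply/eqP; rewrite -(pexpr_eq1 n0) ?cabs_ge0// -cabsX wn.
by rewrite (cabsR 1) normr1.
Qed.

Lemma conj_unit (R : realType) (w : R[i]) : cabs w = 1 -> w * w^* = 1.
Proof. by move=> w1; rewrite -normCK cabsE w1 expr1n. Qed.

(** Averaging [F z * z^-l] over a sufficiently fine set of roots of unity
    isolates the sum of the coefficients of the monomials [z ^ (k + l) * z^* ^ k]. *)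
Lemma circle_coef_bound (R : realType) (B l : nat) (c : nat -> nat -> R[i]) (M : R) :
  (forall j k, (B <= j)%N -> c j k = 0) ->
  (forall z, cabs z = 1 ->
     cabs (\sum_(j < B) \sum_(k < B) c j k * z ^+ j * z^* ^+ k) <= M) ->
  cabs (\sum_(k < B) c (k + l)%N k) <= M.
Proof.
(* The exponents [j] and [k + l] stay below [N], so they agree modulo [N] only if they are equal. *)
move=> c0 cM; pose N := (B + B + l).+1.
have [w wN] := @closed_prim_root R[i] N isT.
have w1 : cabs w = 1 by apply: (@cabs_unit _ N) => //; exact: prim_expr_order wN.
have ww := conj_unit w1.
pose F z := \sum_(j < B) \sum_(k < B) c j k * z ^+ j * z^* ^+ k.
(* This is [w] to the power [j - k - l], since [w^*] is the inverse of [w]. *)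
pose u (j k : nat) := w ^+ j * w^* ^+ (k + l).
have u1 (j k : 'I_B) : (u j k == 1) = (j == k + l :> nat)%N.
  have -> : (u j k == 1) = (w ^+ j == w ^+ (k + l)).
    rewrite -(inj_eq (mulIf (_ : w ^+ (k + l) != 0))); last first.
      by rewrite expf_neq0//; apply: contra_eq_neq ww => ->; rewrite mul0r eq_sym oner_eq0.
    by rewrite /u -mulrA -exprMn [_^* * _]mulrC ww expr1n mulr1 mul1r.
  rewrite (eq_prim_root_expr wN) !modn_small// /N; have := ltn_ord j; have := ltn_ord k; lia.
have uN j k : u j k ^+ N = 1.
  have wN1 : w ^+ N = 1 := prim_expr_order wN.
  have wcN1 : w^* ^+ N = 1 by rewrite -rmorphXn wN1 rmorph1.
  by rewrite /u exprMn -!exprM ![(_ * N)%N]mulnC !exprM wN1 wcN1 !expr1n mulr1.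
have E : \sum_(t < N) F (w ^+ t) * (w^* ^+ l) ^+ t = N%:R * \sum_(k < B) c (k + l)%N k.
  transitivity (\sum_(j < B) \sum_(k < B) c j k * \sum_(t < N) u j k ^+ t).
    under eq_bigr => t _ do rewrite /F mulr_suml.
    rewrite exchange_big; apply: eq_bigr => j _.
    under eq_bigr => t _ do rewrite mulr_suml.
    rewrite exchange_big; apply: eq_bigr => k _.
    rewrite mulr_sumr; apply: eq_bigr => t _.
    rewrite /u rmorphXn /= !exprMn !exprD exprMn -!exprM ![(t * _)%N]mulnC; ring.
  rewrite exchange_big mulr_sumr; apply: eq_bigr => k _ /=.
  have [klB|Bkl] := ltnP (k + l) B; last first.
    rewrite c0// mulr0 big1// => j _; rewrite sum_unity// u1 ifN ?mulr0//.
    by rewrite neq_ltn (leq_trans (ltn_ord j)).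
  rewrite (bigD1 (Ordinal klB)) //= sum_unity// big1 ?addr0.
    by rewrite (u1 (Ordinal klB)) eqxx mulrC.
  by move=> j jkl; rewrite sum_unity// u1 ifN ?mulr0.
have N0 : 0 < N%:R :> R by rewrite ltr0n.
rewrite -(ler_pM2l N0) -{1}(ger0_norm (ltW N0)) -cabsR -cabsM rmorph_nat -E.
apply: (le_trans (cabs_sum _ _)).
rewrite mulr_natl -[X in _ *+ X]card_ord -sumr_const; apply: ler_sum => t _.
rewrite cabsM !cabsX cabs_conj w1 !expr1n mulr1.
by apply: cM; rewrite cabsX w1 expr1n.
Qed.

(** * Approximate coefficients and the nonvanishing test *)

Lemma gauss0 (R : realType) : gauss R 0 = 0.
Proof. by rewrite /gauss /= !subr0 mulr0 addr0 mul0r. Qed.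

Lemma gaussE (R : realType) (c : nat) : gauss R c =
  (((cnth c 0)%:R - (cnth c 1)%:R) / (cnth c 4).+1%:R +i*
   (((cnth c 2)%:R - (cnth c 3)%:R) / (cnth c 4).+1%:R))%C.
Proof.
rewrite /gauss /cnth [RHS]complex_split /= !rmorphM !rmorphB /= !fmorphV /= !rmorph_nat.
by rewrite mulrDl mulrA.
Qed.

Lemma sum_ord_cut (V : nmodType) (m n : nat) (F : nat -> V) : (m <= n)%N ->
  (forall i, (m <= i)%N -> F i = 0) -> \sum_(i < n) F i = \sum_(i < m) F i.
Proof.
move=> mn F0; rewrite -!(big_mkord predT) (big_cat_nat (leq0n m) mn)/=.
rewrite [X in _ + X = _](_ : _ = 0) ?addr0//.
by rewrite big_nat_cond big1// => i /andP[/andP[/F0]].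
Qed.

Lemma cnth_ge c k : (c <= k)%N -> cnth c k = 0%N.
Proof. by move=> ck; rewrite cnth_oversize// (leq_trans (size_decode c)). Qed.

(** A code dominates the number and the lengths of its rows, so the matrix can be padded with zeros
    to a square of side [B]. *)
Lemma ratpolyE (R : realType) (n B : nat) (z : R[i]) : (n <= B)%N ->
  ratpoly n z = \sum_(j < B) \sum_(k < B) gauss R (cnth (cnth n j) k) * z ^+ j * z^* ^+ k.
Proof.
move=> nB; have g0 k : gauss R (cnth 0 k) = 0 by rewrite /cnth nth_nil gauss0.
rewrite /ratpoly size_map.
rewrite -(@sum_ord_cut _ _ B (fun j => \sum_(k < size (nth [::]
  [seq CodeSeq.decode i | i <- CodeSeq.decode n] j)) gauss R (nth 0%N (nth [::]
  [seq CodeSeq.decode i | i <- CodeSeq.decode n] j) k) * z ^+ j * z^* ^+ k)).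
- apply: eq_bigr => j _.
  have -> : nth [::] [seq CodeSeq.decode i | i <- CodeSeq.decode n] j =
      CodeSeq.decode (cnth n j).
    have [jn|nj] := ltnP j (size (CodeSeq.decode n)); first by rewrite (nth_map 0%N).
    by rewrite nth_default ?size_map// cnth_oversize.
  rewrite -(@sum_ord_cut _ _ B (fun k => gauss R (cnth (cnth n j) k) * z ^+ j * z^* ^+ k))//.
    exact: leq_trans (size_decode _) (leq_trans (cnth_le _ _) nB).
  by move=> k kn; rewrite cnth_oversize// gauss0 !mul0r.
- exact: leq_trans (size_decode n) nB.
- by move=> j nj; rewrite nth_default ?size_map// big_ord0.
Qed.

Lemma cont_names_dist (R : realType) (p : baire) (f : cont_space R) n (z : disk R) :
  cont_names p f -> cabs (f z - ratpoly (p n) (set_val z)) <= 2 ^- n.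
Proof.
move=> /(_ n)/ltW; rewrite -lee_fin; apply: le_trans.
by apply: ereal_sup_ubound; exists z.
Qed.

(** The [l]-th Fourier coefficient of [ratpoly c] on the unit circle. *)
Definition diag_coef (R : realType) (c l : nat) : R[i] := \sum_(k < c) gauss R (diag c l k).

(** [circle_coef_bound] applies to the difference of [P] and [ratpoly (p m)]; the coefficients of
    [P] occupy the column [k = 0]. *)
Lemma coef_approx (R : realType) (p : baire) (f : cont_space R) (P : {poly R[i]}) l m :
  cont_names p f -> restricts P f -> cabs (P`_l - diag_coef R (p m) l) <= 2 ^- m.
Proof.
move=> pf Pf; pose B := maxn (size P) (p m).
pose c j k := (if k == 0%N then P`_j else 0) - gauss R (cnth (cnth (p m) j) k).
have -> : P`_l - diag_coef R (p m) l = \sum_(k < B.+1) c (k + l)%N k.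
  rewrite sumrB big_ord_recl /= big1 ?addr0//; congr (_ - _).
  rewrite /diag_coef -(@sum_ord_cut _ _ B.+1 (fun k => gauss R (diag (p m) l k)))//.
    by rewrite ltnW// ltnS leq_maxr.
  move=> i mi; rewrite /diag cnth_ge ?gauss0//.
  exact: leq_trans (cnth_le _ _) mi.
apply: circle_coef_bound => [j k Bj|z z1].
  rewrite /c (cnth_ge (c := p m)); last by rewrite (leq_trans (leq_maxr (size P) _))// ltnW.
  rewrite /cnth nth_nil gauss0 subr0; case: ifP => // _.
  by rewrite nth_default// (leq_trans (leq_maxl _ (p m)))// ltnW.
have z1' : disk R z by rewrite /disk /= z1.
pose zz : disk R := SigSub (mem_set z1').
suff -> : \sum_(j < B.+1) \sum_(k < B.+1) c j k * z ^+ j * z^* ^+ k =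
    f zz - ratpoly (p m) (set_val zz) by exact: cont_names_dist.
rewrite Pf (@ratpolyE R _ B.+1) /=; last by rewrite ltnW// ltnS leq_maxr.
rewrite (horner_coef_wide z (n := B.+1)); last by rewrite ltnW// ltnS leq_maxl.
rewrite -sumrB; apply: eq_bigr => j _.
under eq_bigr do rewrite 2!mulrBl.
rewrite sumrB big_ord_recl /= big1 ?addr0 ?mulr1// => i _.
by rewrite !mul0r.
Qed.

Lemma cnum_cden (F : numFieldType) c l i n :
  (cnum c l i n)%:R / (cden c l n)%:R =
  \sum_(k < n) (cnth (diag c l k) i)%:R / (cnth (diag c l k) 4).+1%:R :> F.
Proof.
elim: n => [|n IH]; first by rewrite big_ord0 /= mul0r.
have D0 k : (cden c l k)%:R != 0 :> F.
  by rewrite pnatr_eq0; elim: k => //= k; rewrite muln_eq0 negb_or => ->.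
have d0 : (cnth (diag c l n) 4).+1%:R != 0 :> F by rewrite pnatr_eq0.
rewrite big_ord_recr -IH /= natrD !natrM; move: d0 (D0 n).
move: (_.+1%:R : F) => d d0 D0n; field.
by rewrite d0.
Qed.

Lemma exceedsP (R : realType) c l m i j : exceeds c l m i j =
  (2 ^- m < `|\sum_(k < c) ((cnth (diag c l k) i)%:R - (cnth (diag c l k) j)%:R) /
     (cnth (diag c l k) 4).+1%:R : R|).
Proof.
under eq_bigr do rewrite mulrBl.
rewrite sumrB -!cnum_cden -mulrBl /exceeds.
have D0 : 0 < (cden c l c)%:R :> R.
  by rewrite ltr0n; elim: {2}c => //= k; rewrite muln_gt0 => ->.
rewrite normrM [X in _ * X]ger0_norm ?invr_ge0 ?ltW//.
rewrite ltr_pdivlMr// [_ * _%:R]mulrC ltr_pdivrMr ?exprn_gt0//.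
move: (cnum c l i c) (cnum c l j c) => a b.
have -> : `|a%:R - b%:R| = ((a - b) + (b - a))%N%:R :> R.
  have [ab|ba] := leqP a b.
    by rewrite distrC ger0_norm ?subr_ge0 ?ler_nat// -natrB// (eqP ab).
  rewrite ger0_norm ?subr_ge0 ?ler_nat ?(ltnW ba)// -natrB ?(ltnW ba)//.
  by rewrite (eqP (ltnW ba)) addn0.
by rewrite -natrX -natrM ltr_nat.
Qed.

Lemma Re_diag_coef (R : realType) c l : complex.Re (diag_coef R c l) =
  \sum_(k < c) ((cnth (diag c l k) 0)%:R - (cnth (diag c l k) 1)%:R) /
    (cnth (diag c l k) 4).+1%:R.
Proof. by apply: etrans (raddf_sum _ _ _ _) _; under eq_bigr do rewrite gaussE. Qed.

Lemma Im_diag_coef (R : realType) c l : complex.Im (diag_coef R c l) =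
  \sum_(k < c) ((cnth (diag c l k) 2)%:R - (cnth (diag c l k) 3)%:R) /
    (cnth (diag c l k) 4).+1%:R.
Proof. by apply: etrans (raddf_sum _ _ _ _) _; under eq_bigr do rewrite gaussE. Qed.

Lemma nonzero_atE (R : realType) (p : baire) l m : nonzero_at p l m =
  (2 ^- m < `|complex.Re (diag_coef R (p m) l)|) ||
  (2 ^- m < `|complex.Im (diag_coef R (p m) l)|).
Proof.
by rewrite /nonzero_at !(exceedsP R) Re_diag_coef Im_diag_coef.
Qed.

Lemma cabs_ReIm (R : realType) (z : R[i]) : cabs z <= `|complex.Re z| + `|complex.Im z|.
Proof.
rewrite {1}[z]complex_split; apply: (le_trans (ler_cabsD _ _)).
by rewrite cabsM cabs_i mul1r !cabsR.
Qed.

Lemma ler_Re_cabs (R : realType) (z : R[i]) : `|complex.Re z| <= cabs z.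
Proof.
rewrite -ler_sqr ?nnegrE ?cabs_ge0// sqr_cabs real_normK ?num_real//.
by rewrite lerDl sqr_ge0.
Qed.

Lemma ler_Im_cabs (R : realType) (z : R[i]) : `|complex.Im z| <= cabs z.
Proof.
rewrite -ler_sqr ?nnegrE ?cabs_ge0// sqr_cabs real_normK ?num_real//.
by rewrite lerDr sqr_ge0.
Qed.

Lemma expn2_small (R : realType) (e : R) : 0 < e -> exists n, 2 ^- n < e.
Proof.
move=> e0; exists (Num.truncn e^-1); rewrite -[X in _ < X]invrK ltf_pV2 ?posrE ?exprn_gt0 ?invr_gt0//.
apply: (lt_le_trans (truncnS_gt _)); rewrite -natrX ler_nat. exact: ltn_expl.
Qed.

Lemma nonzero_atP (R : realType) (p : baire) (f : cont_space R) (P : {poly R[i]}) l :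
  cont_names p f -> restricts P f ->
  (P`_l != 0) <-> (exists m, nonzero_at p l m).
Proof.
move=> pf Pf; split=> [Pl|[m]]; last first.
  rewrite (nonzero_atE R); apply: contraTneq => Pl.
  have := coef_approx l m pf Pf; rewrite Pl sub0r -[- _]sub0r cabs_distC subr0 => h.
  rewrite negb_or -!leNgt.
  by rewrite (le_trans (ler_Re_cabs _) h) (le_trans (ler_Im_cabs _) h).
have Pl0 : 0 < cabs P`_l / 3.
  rewrite divr_gt0// lt_neqAle cabs_ge0 andbT eq_sym; apply: contra Pl => /eqP h.
  by apply/eqP/ComplexField.Normc.eq0_normc.
have [m mP] := expn2_small Pl0; exists m; rewrite (nonzero_atE R); apply: contraLR mP.
rewrite negb_or -!leNgt => /andP[hr hi].
have := coef_approx l m pf Pf; have := cabs_ReIm (diag_coef R (p m) l).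
have := ler_cabsD (P`_l - diag_coef R (p m) l) (diag_coef R (p m) l); rewrite subrK; lra.
Qed.

(** * Reductions to closed choice *)

(** All three problems use the same instance of closed choice; they differ in what [eK] computes
    from the degree and the name [p]. *)
Lemma degree_reduction (R : realType) (g : problem (cont_space R) nat_space) (eK : expr) :
  dom g = @poly_restriction R ->
  (forall (p q : baire) (f : cont_space R) P, cont_names p f -> restricts P f ->
     cnth (q 0%N) 0 = poly_deg P -> sol g f (denote (baire_join p q) [:: 0%N] eK)) ->
  weihrauch_le g closed_choice.
Proof.
move=> dg gP; apply: (weihrauch_le_eval (eH := sval degree_input_prog) (eK := eK)).
move=> p f pf; rewrite dg => -[P Pf].
pose H n := denote p [:: n] (sval degree_input_prog).
have HE n : H n = (refuted p (cnth n 0) (cnth n 1) (cnth n 2) * (cnth n 0).+1)%N.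
  exact: (svalP degree_input_prog p n).
pose A := ~` [set k | exists n, (0 < H n)%N /\ k = (H n).-1].
have AE w : A w <-> forall l m, ~~ refuted p w l m.
  split=> [Aw l m|nw [n []]].
    apply/negP => r; apply: Aw; exists (CodeSeq.code [:: w; l; m]).
    by rewrite HE !cnth_code /= r mul1n.
  rewrite HE; case: (boolP (refuted _ _ _ _)) => //; rewrite mul1n => + _ /= wE.
  by rewrite -wE; apply/negP/nw.
have nz l := nonzero_atP l pf Pf.
have Pn l : (poly_deg P < l)%N -> P`_l = 0.
  by move=> Pl; apply: nth_default; move: Pl; rewrite /poly_deg; case: size.
(* In degree 0 the leading coefficient may vanish, namely for [P = 0]. *)
have lead : (0 < poly_deg P)%N -> P`_(poly_deg P) != 0.
  by rewrite /poly_deg -/(lead_coef P) lead_coef_eq0 -size_poly_eq0; case: size.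
exists A; split.
- by rewrite /= /closed_names setCK.
- have [m mP] : exists m, (0 < poly_deg P)%N -> nonzero_at p (poly_deg P) m.
    have [/lead/nz[m mP]|] := ltnP 0 (poly_deg P); first by exists m.
    by exists 0%N.
  exists (CodeSeq.code [:: poly_deg P; m]); apply/AE => l k.
  rewrite /refuted !cnth_code /= negb_or !negb_and negbK.
  apply/andP; split; first by case: (posnP (poly_deg P)) => [->//|/mP->]; rewrite orbT.
  have [/Pn Pl|//] := ltnP (poly_deg P) l.
  by apply/negP => lk; have /nz : exists m, nonzero_at p l m by [exists k]; rewrite Pl eqxx.
- move=> q w qw /AE Aw; exists (denote (baire_join p q) [:: 0%N] eK) => //.
  apply: gP Pf _ => //; rewrite qw.
  (* Too small a candidate is refuted by the leading coefficient. Too large a one has coefficient 0,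
     so its witness fails whatever the evidence. *)
  case: (ltngtP (cnth w 0) (poly_deg P)) => // h.
    have /lead/nz[m mP] : (0 < poly_deg P)%N by exact: leq_ltn_trans h.
    by have := Aw (poly_deg P) m; rewrite /refuted h mP orbT.
  have w0 : (0 < cnth w 0)%N by exact: leq_ltn_trans h.
  have := Aw 0%N 0%N; rewrite /refuted w0 /= negb_or negbK => /andP[nw _].
  by have /nz : exists m, nonzero_at p (cnth w 0) m by [exists (cnth w 1)]; rewrite Pn ?eqxx.
Qed.

Lemma deg_le_choice (R : realType) : weihrauch_le (deg_problem R) closed_choice.
Proof.
apply: (degree_reduction (eK := sval degree_output_prog)) => // p q f P _ Pf qP.
by exists P; rewrite (svalP degree_output_prog) qP.
Qed.

Lemma dbnd_le_choice (R : realType) : weihrauch_le (dbnd_problem R) closed_choice.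
Proof.
apply: (degree_reduction (eK := sval degree_output_prog)) => // p q f P _ Pf qP.
by exists P; rewrite (svalP degree_output_prog) qP.
Qed.

(** * Bounds and power series of polynomials *)

Lemma cabs_gauss (R : realType) c : cabs (gauss R c) <= 4 * c%:R.
Proof.
rewrite gaussE; apply: (le_trans (cabs_ReIm _)) => /=.
have h i j : `|((cnth c i)%:R - (cnth c j)%:R) / (cnth c 4).+1%:R| <= 2 * c%:R :> R.
  rewrite normrM [X in _ * X]ger0_norm ?invr_ge0// ler_pdivrMr ?ltr0n//.
  apply: (@le_trans _ _ (2 * c%:R)); last first.
    by rewrite ler_peMr ?mulr_ge0// ler1n.
  apply: (le_trans (ler_normB _ _)); rewrite !normr_nat mulr_natl mulr2n.
  by apply: lerD; rewrite ler_nat cnth_le.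
have := h 0%N 1%N; have := h 2%N 3%N; lra.
Qed.

(** Each coefficient lies within 1 of a sum of [p 0] Gaussian rationals, each of absolute value at
    most [4 * p 0]. The powers of 2 up to the degree sum to less than [2 ^ (poly_deg P).+1]. *)
Lemma poly_bound (R : realType) (p : baire) (f : cont_space R) (P : {poly R[i]}) (z : R[i]) :
  cont_names p f -> restricts P f -> cabs z <= 2 ->
  cabs P.[z] <= (2 ^ (poly_deg P).+1 * (4 * p 0 ^ 2).+1)%N%:R.
Proof.
move=> pf Pf z2; set C : R := (4 * p 0%N ^ 2).+1%:R.
have PC l : cabs P`_l <= C.
  have := coef_approx l 0 pf Pf; rewrite expr0 invr1.
  have : cabs (diag_coef R (p 0%N) l) <= (4 * p 0%N ^ 2)%:R.
    apply: (le_trans (cabs_sum _ _)).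
    apply: (@le_trans _ _ (\sum_(k < p 0%N) (4 * (p 0%N)%:R))).
      apply: ler_sum => k _; apply: (le_trans (cabs_gauss _ _)).
      rewrite ler_pM2l ?ltr0n// ler_nat; exact: leq_trans (cnth_le _ _) (cnth_le _ _).
    by rewrite sumr_const card_ord -mulr_natl natrM natrX; lra.
  have := ler_cabsD (P`_l - diag_coef R (p 0%N) l) (diag_coef R (p 0%N) l); rewrite subrK.
  rewrite /C -natr1; lra.
have C0 : 0 <= C by [].
rewrite natrM natrX -/C (horner_coef_wide _ (n := (poly_deg P).+1)); last first.
  by rewrite /poly_deg; case: size.
apply: (le_trans (cabs_sum _ _)).
apply: (@le_trans _ _ (\sum_(i < (poly_deg P).+1) C * 2 ^+ i)).
  apply: ler_sum => i _; rewrite cabsM cabsX; apply: ler_pM; rewrite ?exprn_ge0 ?cabs_ge0//.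
  by apply: lerXn2r; rewrite ?nnegrE ?cabs_ge0.
rewrite -mulr_sumr mulrC ler_wpM2r//.
have := subrX1 (2 : R) (poly_deg P).+1; have -> : 2 - 1 = 1 :> R by ring.
rewrite mul1r => <-; lra.
Qed.

(** The coefficients are those of [P] composed with ['X + z0], and the partial sums are eventually
    constant. *)
Lemma horner_series (R : realType) (P : {poly R[i]}) z0 :
  exists b : nat -> R[i], forall z, series (fun n => b n * (z - z0) ^+ n) @ \oo --> P.[z].
Proof.
pose Q := P \Po ('X + z0%:P); exists (fun n => Q`_n) => z.
have -> : P.[z] = \sum_(n < size Q) Q`_n * (z - z0) ^+ n.
  by rewrite -horner_coef /Q horner_comp !hornerE subrK.
apply: cvg_near_cst; exists (size Q) => // n /= Qn.
rewrite /series /= big_mkord.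
apply: (sum_ord_cut (F := fun i => Q`_i * (z - z0) ^+ i)) => // i Qi.
by rewrite nth_default// mul0r.
Qed.

(** The exponent [1 / (m + 1)] is at most 1. *)
Lemma closure_adv_disk (R : realType) m (z : R[i]) :
  closure (adv_disk R m) z -> cabs z <= 2.
Proof.
move=> zm; apply/ler_addgt0Pr => e e0.
have e0' : 0 < e%:C%C :> R[i] by rewrite ltcR.
have [w [wm]] := zm _ (nbhsx_ballx z _ e0').
rewrite -ball_normE /= cabsE ltcR => zw.
have w2 : cabs w < 2.
  apply: (lt_le_trans wm); rewrite -[X in _ <= X]powRr1//.
  by rewrite ler_powR ?ler1n// invf_le1 ?ler1n ?ltr0n.
by have := ler_cabsD (z - w) w; rewrite subrK; lra.
Qed.

Lemma adv_le_choice (R : realType) : weihrauch_le (adv_problem R) closed_choice.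
Proof.
apply: (degree_reduction (eK := sval bound_output_prog)) => // p q f P pf Pf qP.
exists setT, (horner P); split.
- exact: openT.
- by [].
- by move=> z _; have [b bP] := horner_series P z; exists b, 1.
- by move=> z; rewrite Pf.
- move=> z /closure_adv_disk z2; rewrite (svalP bound_output_prog) qP.
  exact: poly_bound.
Qed.

(** * Reductions of closed choice *)

Section Guess.
Variables (p : baire) (A : set nat).
Hypothesis pA : closed_names p A.

Lemma guessS s : guess p s.+1 = (guess p s + changes p s)%N.
Proof. by []. Qed.

Lemma changes_notin s : changes p s -> ~ A (guess p s).
Proof.
rewrite /changes lt0n sum_nat_eq0 => /forallPn[k] /=; rewrite eqb0 negbK => /eqP pk Ag.
have : (~` A) (guess p s) by rewrite pA; exists k; rewrite pk.
exact.
Qed.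

(** The guess moves by steps of 1 and only away from non-members, so it cannot pass a member. *)
Lemma guess_le s a : A a -> (guess p s <= a)%N.
Proof.
move=> Aa; elim: s => // s IH; rewrite guessS.
case: (boolP (changes p s)) => [/changes_notin ng|_]; last by rewrite addn0.
rewrite addn1 ltn_neqAle IH andbT; apply/eqP => ga.
by apply: ng; rewrite ga.
Qed.

Lemma guess_mono s t : (s <= t)%N -> (guess p s <= guess p t)%N.
Proof.
move=> /subnK <-; elim: (t - s)%N => //= n IH.
exact: leq_trans IH (leq_addr _ _).
Qed.

(** Were the final guess outside [A], some entry [n] would exclude it, and every stage after [n]
    would see that entry. *)
Lemma guess_in m : (forall s, (m <= s)%N -> ~~ changes p s) -> A (guess p m).
Proof.
move=> nc; have st s : (m <= s)%N -> guess p s = guess p m.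
  move=> /subnK <-; elim: (s - m)%N => // n IH; rewrite addSn guessS IH.
  by rewrite (negbTE (nc _ (leq_addl _ _))) addn0.
apply: contrapT => nA; have : (~` A) (guess p m) by [].
rewrite pA => -[n [pn gn]]; have := nc (maxn m n.+1) (leq_maxl _ _).
move/negP; apply; rewrite /changes st ?leq_maxl// gn prednK// lt0n sum_nat_eq0.
apply/forallPn; exists (Ordinal (leq_maxr m n.+1)) => /=.
by rewrite eqxx.
Qed.

(** The guesses are bounded by a member of [A]; from a stage where their maximum is attained they
    stay constant. *)
Lemma changes_finite : A !=set0 -> exists S, forall s, (S <= s)%N -> ~~ changes p s.
Proof.
move=> [a Aa]; pose B := [pred v | `[< exists s, guess p s = v >]].
have exB : exists v, B v by exists 0%N; apply/asboolP; exists 0%N.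
have Ba v : B v -> (v <= a)%N by move=> /asboolP[s <-]; exact: guess_le.
case: (ex_maxnP exB Ba) => v /asboolP[S Sv] vmax; exists S => s Ss.
apply/negP => cs; have : B (guess p s.+1) by apply/asboolP; exists s.+1.
by move=> /vmax; rewrite guessS cs addn1 -Sv leqNgt ltnS guess_mono.
Qed.

End Guess.

(** * The stage polynomials *)

Lemma expo_incr s t : (s < t)%N = (expo s < expo t)%N.
Proof. rewrite /expo -!muln2; apply/idP/idP; nia. Qed.

Lemma expo_inj : injective expo.
Proof. by move=> s t st; case: (ltngtP s t) => //; rewrite expo_incr st ltnn. Qed.

Lemma expo_ge s : (s < expo s)%N.
Proof. by rewrite /expo -muln2; nia. Qed.

Definition stage_poly (R : realType) (a : nat -> bool) (n : nat) : {poly R[i]} :=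
  \sum_(s < n) ((a s)%:R / 2 ^+ s.+1) *: 'X^(expo s).

Lemma stage_poly_coef (R : realType) a n s : (s < n)%N ->
  (stage_poly R a n)`_(expo s) = (a s)%:R / 2 ^+ s.+1.
Proof.
move=> sn; rewrite /stage_poly coef_sum (bigD1 (Ordinal sn)) //= big1 ?addr0.
  by rewrite coefZ coefXn eqxx mulr1.
move=> t ts; rewrite coefZ coefXn (inj_eq expo_inj) eq_sym.
by have /negbTE -> : t != s :> nat by []; rewrite mulr0.
Qed.

Lemma horner_stage_poly (R : realType) a n (z : R[i]) :
  (stage_poly R a n).[z] = \sum_(s < n) (a s)%:R / 2 ^+ s.+1 * z ^+ expo s.
Proof. by rewrite horner_sum; under eq_bigr do rewrite hornerZ hornerXn. Qed.

Lemma gauss_rowcode (R : realType) (p : baire) n j : (j < expo n.+1)%N ->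
  gauss R (rowcode p j) =
  \sum_(s < n.+1) if expo s == j then (changes p s)%:R / 2 ^+ s.+1 else 0.
Proof.
move=> jn; have gc s : gauss R (changes p s * coefcode s) = (changes p s)%:R / 2 ^+ s.+1.
  case: changes; last by rewrite mul0n gauss0 mul0r.
  rewrite mul1n /gauss /coefcode CodeSeq.codeK /=.
  by rewrite !subr0 mulr0 addr0 prednK ?expn_gt0// natrX.
have [[s sj]|nj] := pselect (exists s, expo s = j).
  have sn : (s < n.+1)%N by rewrite expo_incr sj.
  have sj1 : (s < j.+1)%N by rewrite ltnS ltnW// -sj expo_ge.
  rewrite /rowcode (sum_nat_single sj1 (F := fun s => (expo s == j) * (changes p s * coefcode s))%N).
    rewrite sj eqxx mul1n gc (bigD1 (Ordinal sn)) //= sj eqxx big1 ?addr0// => t ts.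
    by rewrite -sj (inj_eq expo_inj) ifN.
  by move=> t ts; rewrite -sj (inj_eq expo_inj) (negbTE ts).
have nE s : (expo s == j) = false by apply/eqP => sj; apply: nj; exists s.
rewrite /rowcode big1 => [|s _]; last by rewrite nE.
by rewrite gauss0 big1// => s _; rewrite nE.
Qed.

Lemma ratpoly_polycode (R : realType) (p : baire) n (z : R[i]) :
  ratpoly (polycode p n) z = (stage_poly R (changes p) n.+1).[z].
Proof.
rewrite /ratpoly /polycode CodeSeq.codeK -map_comp.
rewrite size_map size_iota horner_stage_poly.
transitivity (\sum_(j < expo n.+1) gauss R (rowcode p j) * z ^+ j).
  apply: eq_bigr => j _; rewrite (nth_map 0%N) ?size_iota// nth_iota// add0n /comp.
  by rewrite CodeSeq.codeK big_ord1 /= expr0 mulr1.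
under eq_bigr => j _ do rewrite (@gauss_rowcode R p n)// mulr_suml.
rewrite exchange_big; apply: eq_bigr => s _ /=.
have sn : (expo s < expo n.+1)%N by rewrite -expo_incr.
rewrite (bigD1 (Ordinal sn)) //= eqxx big1 ?addr0// => j js.
by rewrite ifN ?mul0r// eq_sym.
Qed.

(** * Geometric sums and the identity theorem *)

Lemma sum_half (R : realFieldType) m n : (m <= n)%N ->
  \sum_(m <= s < n) 1 / 2 ^+ s.+1 = 1 / 2 ^+ m - 1 / 2 ^+ n :> R.
Proof.
elim: n => [|n IH]; first by rewrite leqn0 => /eqP ->; rewrite big_geq// subrr.
rewrite leq_eqVlt => /predU1P[->|]; first by rewrite big_geq// subrr.
rewrite ltnS => mn; rewrite big_nat_recr//= IH// exprS.
have : (2 ^+ n : R) != 0 by rewrite expf_neq0.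
by move: (2 ^+ n : R) (1 / 2 ^+ m : R) => x y x0; field.
Qed.

Lemma sum_geo_half (R : realFieldType) (q : R) m n : 0 <= q -> 2 * q <= 1 -> (m <= n)%N ->
  \sum_(m <= k < n) q ^+ k <= 2 * q ^+ m.
Proof.
(* The added [2 * q ^+ n] makes the induction go through. *)
move=> q0 q1 mn; suff : \sum_(m <= k < n) q ^+ k + 2 * q ^+ n <= 2 * q ^+ m.
  by have := exprn_ge0 n q0; lra.
elim: n mn => [|n IH]; first by rewrite leqn0 => /eqP ->; rewrite big_geq// add0r.
rewrite leq_eqVlt => /predU1P[->|]; first by rewrite big_geq// add0r.
rewrite ltnS => mn; rewrite big_nat_recr//= exprS.
by have := IH mn; have := exprn_ge0 n q0; nra.
Qed.

(** At the first nonzero coefficient [c n], the remaining terms are [O(h ^ n.+1)]. *)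
Lemma power_series_eq0 (R : realType) (c : nat -> R[i]) (r : R) : 0 < r ->
  (forall h : R, 0 < h < r -> series (fun n => c n * (- h%:C%C) ^+ n) @ \oo --> (0 : R[i])) ->
  forall n, c n = 0.
Proof.
move=> r0 c0; pose rho := r / 2; have rho0 : 0 < rho by rewrite divr_gt0.
(* The terms of the series converging at [- rho] are bounded. *)
have [C CP] : exists C : R, forall k, cabs (c k) * rho ^+ k <= C.
  have /c0 h : 0 < rho < r by rewrite rho0 /rho; lra.
  have /cvg_series_cvg_0 h0 : cvgn (series (fun n => c n * (- rho%:C%C) ^+ n)).
    by apply/cvg_ex; exists 0.
  have /cvg_seq_bounded[M [Mreal MP]] : cvgn (fun n => c n * (- rho%:C%C) ^+ n).
    by apply/cvg_ex; exists 0.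
  exists (complex.Re (M + 1)) => k.
  have M1 : M < M + 1 by rewrite ltrDl.
  have := MP _ M1 k I; rewrite /= cabsE cabsM cabsX.
  have -> : cabs (- rho%:C%C) = rho by rewrite -rmorphN cabsR normrN gtr0_norm.
  by rewrite lecE /= => /andP[].
have C0 : 0 <= C by apply: le_trans (CP 0%N); rewrite mulr_ge0 ?cabs_ge0.
elim/ltn_ind => n IH; apply/ComplexField.Normc.eq0_normc; rewrite -/(cabs _).
apply/eqP; rewrite eq_le cabs_ge0 andbT leNgt; apply/negP => cn0.
have main h : 0 < h -> h <= rho / 2 -> cabs (c n) <= 2 * C / rho ^+ n.+1 * h.
  move=> h0 hrho; have q0 : 0 <= h / rho by rewrite divr_ge0 ?ltW.
  have q1 : 2 * (h / rho) <= 1 by rewrite mulrA ler_pdivrMr//; lra.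
  have hr : 0 < h < r by rewrite h0 /=; move: hrho; rewrite /rho; lra.
  have cabsh : cabs (- h%:C%C) = h by rewrite -rmorphN cabsR normrN gtr0_norm.
  rewrite -(ler_pM2r (exprn_gt0 n h0)).
  suff : cabs (c n) * h ^+ n <= C * (2 * (h / rho) ^+ n.+1).
    by rewrite exprMn exprVn [h ^+ n.+1]exprS; congr (_ <= _); ring.
  apply/ler_addgt0Pl => e e0.
  have e0' : 0 < e%:C%C :> R[i] by rewrite ltcR.
  have /cvgrPdist_lt/(_ _ e0')[N _ NP] := c0 h hr.
  pose M := maxn N n.+1; have := NP M (leq_maxl _ _).
  rewrite /= sub0r normrN cabsE ltcR /series /= (big_cat_nat (leq0n n.+1)) ?leq_maxr//=.
  rewrite big_nat_recr//= big_nat_cond big1 ?add0r => [SM|k /andP[/andP[_ kn] _]]; last first.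
    by rewrite IH// mul0r.
  have tail : cabs (\sum_(n.+1 <= k < M) c k * (- h%:C%C) ^+ k) <= C * (2 * (h / rho) ^+ n.+1).
    apply: (le_trans (cabs_sum _ _)).
    apply: le_trans (ler_wpM2l C0 (sum_geo_half q0 q1 (leq_maxr N n.+1))).
    rewrite mulr_sumr; apply: ler_sum => k _; rewrite cabsM cabsX cabsh.
    rewrite expr_div_n mulrA ler_pdivlMr ?exprn_gt0// mulrAC.
    by apply: ler_wpM2r (CP k); rewrite exprn_ge0// ltW.
  rewrite -{1}cabsh -cabsX -cabsM; move: SM tail.
  move: (c n * _) (\sum_(n.+1 <= k < M) c k * (- h%:C%C) ^+ k) => x y.
  have := ler_cabsD (x + y) (- y); rewrite addrK.
  have -> : cabs (- y) = cabs y by rewrite -sub0r cabs_distC subr0.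
  lra.
pose K := 2 * C / rho ^+ n.+1.
have K0 : 0 <= K by rewrite divr_ge0 ?mulr_ge0// exprn_ge0// ltW.
(* Small enough that [K * h < cabs (c n)], against [main]. *)
pose h := Order.min (rho / 2) (cabs (c n) / (2 * (K + 1))).
have h0 : 0 < h by rewrite lt_min !divr_gt0// mulr_gt0// ltr_pwDr.
have h1 : h <= rho / 2 by rewrite ge_min lexx.
have h2 : h * (2 * (K + 1)) <= cabs (c n).
  by rewrite -ler_pdivlMr ?mulr_gt0 ?ltr_pwDr// ge_min lexx orbT.
by have := main h h0 h1; rewrite -/K; nra.
Qed.

(** The two power series at [t0] agree at all [t0 - h] with small [h > 0], so [power_series_eq0]
    identifies their coefficients. *)
Lemma analytic_eq_poly (R : realType) (g : R[i] -> R[i]) (P : {poly R[i]}) (t0 : R) (d : R) :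
  analytic_at g t0%:C%C -> 0 < d ->
  (forall u : R, t0 - d < u < t0 -> g u%:C%C = P.[u%:C%C]) ->
  exists2 r : R, 0 < r & forall z, cabs (z - t0%:C%C) < r -> g z = P.[z].
Proof.
move=> [a [r [r0 ga]]] d0 gP; exists r => // z zr.
have [b Pb] := horner_series P t0%:C%C.
have ab n : a n - b n = 0.
  have e0 : 0 < Order.min r d by rewrite lt_min r0.
  apply: (power_series_eq0 (c := fun n => a n - b n) e0) => h /andP[h0].
  rewrite lt_min => /andP[hr hd].
  pose w : R := t0 - h; have wt : w%:C%C - t0%:C%C = - h%:C%C.
    by rewrite -rmorphB -rmorphN /w; congr (_%:C)%C; ring.
  have -> : series (fun n => (a n - b n) * (- h%:C%C) ^+ n) =
      series (fun n => a n * (w%:C%C - t0%:C%C) ^+ n) -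
      series (fun n => b n * (w%:C%C - t0%:C%C) ^+ n).
    apply/funext => k; rewrite /series /= !fctE /= -sumrB; apply: eq_bigr => j _.
    by rewrite wt mulrBl.
  rewrite -(subrr (g w%:C%C)) {2}gP; last by rewrite /w; apply/andP; split; lra.
  apply: cvgB; last exact: Pb.
  by apply: ga; rewrite wt -rmorphN cabsR normrN gtr0_norm.
have ba : b = a by apply/funext => n; have /eqP := ab n; rewrite subr_eq0 => /eqP.
move: Pb; rewrite ba => Pb.
exact: (cvg_unique (@norm_hausdorff _ _) (ga z zr) (Pb z)).
Qed.

(** Agreement propagates along the segment: at the supremum [s] of the reached points, the power
    series carries it past [s] unless [s = T]. *)
Lemma identity_segment (R : realType) (g : R[i] -> R[i]) (P : {poly R[i]}) (T : R) :
  (forall u : R, 0 <= u <= T -> analytic_at g u%:C%C) ->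
  (forall u : R, 0 <= u <= 1 -> g u%:C%C = P.[u%:C%C]) ->
  1 <= T -> g T%:C%C = P.[T%:C%C].
Proof.
move=> ga gP T1.
pose E : set R := [set t | 1 <= t <= T /\ forall u, 0 <= u <= t -> g u%:C%C = P.[u%:C%C]].
have E1 : E 1 by split; rewrite ?lexx.
have ubE : ubound E T by move=> t [/andP[]].
have supE : has_sup E by split; [exists 1|exists T].
pose s := sup E; have s1 : 1 <= s by exact: ub_le_sup (ex_intro _ T ubE) _ E1.
have sT : s <= T by apply: ge_sup => //; exists 1.
have below u : 0 <= u < s -> g u%:C%C = P.[u%:C%C].
  move=> /andP[u0 us]; have su : 0 < s - u by rewrite subr_gt0.
  have [t [_ tP]] := sup_adherent su supE; rewrite -/s subKr => ut.
  by apply: tP; rewrite u0 ltW.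
have [r r0 rP] : exists2 r : R, 0 < r & forall z, cabs (z - s%:C%C) < r -> g z = P.[z].
  (* As [1 <= s], agreement is known on all of the interval from [s - 1] to [s]. *)
  apply: (@analytic_eq_poly _ _ _ s 1) => //; first by apply: ga; lra.
  by move=> u us; apply: below; lra.
pose t := Order.min T (s + r / 2).
have near u : 0 <= u <= t -> g u%:C%C = P.[u%:C%C].
  rewrite le_min => /andP[u0 /andP[uT us]].
  have [lus|lsu] := ltP u s; first by apply: below; rewrite u0.
  apply: rP; rewrite -rmorphB cabsR ger0_norm ?subr_ge0//; lra.
have Et : E t by split=> //; rewrite le_min ge_min lexx /=; apply/andP; split; lra.
have : t <= s by exact: ub_le_sup (ex_intro _ T ubE) _ Et.
rewrite /t ge_min => /orP[Ts|?]; last by exfalso; lra.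
by apply: near; rewrite /t le_min lexx; apply/andP; split; lra.
Qed.

(** * Stage polynomials as instances of the three problems *)

Lemma poly_restriction_ex (R : realType) (P : {poly R[i]}) :
  exists f : cont_space R, restricts P f.
Proof.
have cP : continuous (horner P).
  elim/poly_ind: P => [|P c IH].
    have -> : horner (0 : {poly R[i]}) = cst 0 by apply/funext => w; rewrite horner0.
    exact: cst_continuous.
  have -> : horner (P * 'X + c%:P) = (fun w => P.[w] * w + c).
    by apply/funext => w; rewrite hornerMXaddC.
  by move=> z; apply: (cvgD (cvgM (IH z) (@cvg_id _ (nbhs z))) (cvg_cst c)).
have cf : continuous (fun z : disk R => P.[set_val z]).
  move=> z; apply: (@continuous_comp _ _ _ (set_val : disk R -> R[i]) (horner P)).
    exact: initial_continuous.
  exact: cP.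
by exists [the continuousType (disk R) R[i] of mkcts cf].
Qed.

Lemma stage_poly_cut (R : realType) a m n : (m <= n)%N ->
  (forall s, (m <= s)%N -> ~~ a s) -> stage_poly R a n = stage_poly R a m.
Proof.
move=> mn am; apply: (sum_ord_cut (F := fun s => ((a s)%:R / 2 ^+ s.+1) *: 'X^(expo s))) => // s.
by move=> /am /negbTE ->; rewrite mul0r scale0r.
Qed.

Lemma coefR (R : realType) (b : bool) s :
  b%:R / 2 ^+ s.+1 = (b%:R / 2 ^+ s.+1 : R)%:C%C.
Proof. by rewrite rmorphM fmorphV rmorphXn /= !rmorph_nat. Qed.

Lemma stage_poly_tail (R : realType) a m n (z : R[i]) : (m <= n)%N -> cabs z <= 1 ->
  cabs ((stage_poly R a n).[z] - (stage_poly R a m).[z]) <= 2 ^- m.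
Proof.
move=> mn z1; rewrite !horner_stage_poly -!(big_mkord predT (fun s => (a s)%:R / 2 ^+ s.+1 * z ^+ expo s)).
rewrite (big_cat_nat (leq0n m) mn) /= addrAC subrr add0r.
apply: (le_trans (cabs_sum _ _)).
apply: (@le_trans _ _ (\sum_(m <= s < n) 1 / 2 ^+ s.+1)); last first.
  rewrite sum_half// div1r gerBl div1r invr_ge0 exprn_ge0//.
apply: ler_sum => s _; rewrite coefR cabsM cabsR cabsX ger0_norm ?divr_ge0//.
apply: (@le_trans _ _ ((a s)%:R / 2 ^+ s.+1)).
  by rewrite ler_piMr ?divr_ge0// exprn_ile1// cabs_ge0.
by rewrite ler_wpM2r ?invr_ge0 ?exprn_ge0//; case: (a s).
Qed.

(** The second hypothesis says that a solution bounds the stages of change, so the guess at that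
    stage is final and lies in [A]. *)
Lemma choice_reduction (R : realType) (g : problem (cont_space R) nat_space) :
  dom g = @poly_restriction R ->
  (forall (f : cont_space R) a S y s, restricts (stage_poly R a S) f -> sol g f y ->
     (y <= s)%N -> (s < S)%N -> ~~ a s) ->
  weihrauch_le closed_choice g.
Proof.
move=> dg gP; apply: (weihrauch_le_eval (eH := sval poly_input_prog)
  (eK := sval guess_output_prog)) => p A pA A0.
have [S SP] := changes_finite pA A0.
(* The bound [S] serves only to describe the limit; the computed name consists of partial sums. *)
have [f fP] := poly_restriction_ex (stage_poly R (changes p) S).
exists f; split.
- move=> n; rewrite (svalP poly_input_prog).
  apply: (@le_lt_trans _ _ (2 ^- n.+1)%:E).
    apply: ge_ereal_sup => _ [z _ <-]; rewrite lee_fin fP ratpoly_polycode.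
    rewrite -(stage_poly_cut R (leq_maxl S n.+1) SP).
    by apply: stage_poly_tail; rewrite ?leq_maxr ?disk_val.
  by rewrite lte_fin ltf_pV2 ?posrE ?exprn_gt0 // ltr_eXn2l // ltr1n.
- by rewrite dg; exists (stage_poly R (changes p) S).
- move=> q y qy gy; exists (guess p y).
    by rewrite /= /nat_names (svalP guess_output_prog) qy.
  apply: (guess_in pA) => s ys; have [sS|Ss] := ltnP s S; last exact: SP.
  exact: gP fP gy ys sS.
Qed.

(** Both sides are equivalent to the success of a test on a common name of [f]. *)
Lemma restricts_coef (R : realType) (f : cont_space R) (P Q : {poly R[i]}) l :
  restricts P f -> restricts Q f -> (P`_l != 0) = (Q`_l != 0).
Proof.
move=> Pf Qf; have [p pf] := cont_names_surj f.
by apply/idP/idP => /(nonzero_atP _ pf _) h; apply/(nonzero_atP _ pf _); try exact: h.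
Qed.

(** A change at [s] would give a nonzero coefficient at [expo s], which exceeds the degree. *)
Lemma stage_poly_deg (R : realType) (f : cont_space R) a S (P : {poly R[i]}) s :
  restricts (stage_poly R a S) f -> restricts P f ->
  (poly_deg P <= s)%N -> (s < S)%N -> ~~ a s.
Proof.
move=> Wf Pf Ps sS; apply/negP => as1; have := restricts_coef (expo s) Wf Pf.
rewrite stage_poly_coef// as1 mul1r invr_eq0 expf_eq0 /= pnatr_eq0 /= => /esym.
rewrite nth_default ?eqxx//; move: Ps (expo_ge s); rewrite /poly_deg.
by case: (size P) => //= n; exact: leq_ltn_trans.
Qed.

Lemma choice_le_deg (R : realType) : weihrauch_le closed_choice (deg_problem R).
Proof.
apply: choice_reduction => // f a S y s Wf [P [Pf ->]] ys.
exact: stage_poly_deg Wf Pf ys.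
Qed.

Lemma choice_le_dbnd (R : realType) : weihrauch_le closed_choice (dbnd_problem R).
Proof.
apply: choice_reduction => // f a S y s Wf [P [Pf Py]] ys.
exact: stage_poly_deg Wf Pf (leq_trans Py ys).
Qed.

Lemma powR_root (R : realType) (n : nat) : (2 `^ n.+1%:R^-1) ^+ n.+1 = 2 :> R.
Proof. by rewrite -powR_mulrn ?powR_ge0// -powRrM mulVf ?pnatr_eq0// powRr1. Qed.

Lemma choice_le_adv (R : realType) : weihrauch_le closed_choice (adv_problem R).
Proof.
apply: choice_reduction => // f a S y s Wf [V [g [_ adV gV gf gy]]] ys sS.
apply/negP => as1; pose t : R := 2 `^ y.+2%:R^-1; pose r : R := 2 `^ y.+1%:R^-1.
have t0 : 0 <= t by exact: powR_ge0.
have t1 : 1 <= t by rewrite -(powRr0 2) ler_powR ?ler1n// invr_ge0.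
have tE : t ^+ y.+2 = 2 by exact: powR_root.
have tr : t < r.
  rewrite ltNge; apply/negP => rt; have r0 : 0 <= r by exact: powR_ge0.
  have rE : r ^+ y.+1 = 2 by exact: powR_root.
  have r1 : 1 < r.
    rewrite ltNge; apply/negP => r1; have := exprn_ile1 y.+1 r0 r1; rewrite rE; lra.
  (* The left side is [2 * r], which exceeds 2, and the right side is 2. *)
  have : r ^+ y.+2 <= t ^+ y.+2 by apply: lerXn2r; rewrite ?nnegrE.
  by rewrite tE exprS rE; lra.
have adv u : 0 <= u <= t -> closure (adv_disk R y) u%:C%C.
  move=> /andP[u0 ut]; apply: subset_closure.
  by rewrite /adv_disk /= cabsR ger0_norm// (le_lt_trans ut).
have gW u : 0 <= u <= 1 -> g u%:C%C = (stage_poly R a S).[u%:C%C].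
  move=> /andP[u0 u1]; have u1' : disk R u%:C%C by rewrite /disk /= cabsR ger0_norm.
  by have := gf (SigSub (mem_set u1')); rewrite Wf.
have gt : g t%:C%C = (stage_poly R a S).[t%:C%C].
  by apply: identity_segment gW t1 => u ut; apply/gV/adV/adv.
have := gy t%:C%C (adv t _); rewrite t0 lexx => /(_ isT); apply/negP; rewrite -ltNge gt.
have -> : (stage_poly R a S).[t%:C%C] =
    (\sum_(s < S) (a s)%:R / 2 ^+ s.+1 * t ^+ expo s)%:C%C.
  rewrite horner_stage_poly rmorph_sum; apply: eq_bigr => i _.
  by rewrite [RHS]rmorphM rmorphXn coefR.
have pos (i : nat) : 0 <= (a i)%:R / 2 ^+ i.+1 * t ^+ expo i.
  by rewrite mulr_ge0 ?divr_ge0 ?exprn_ge0.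
rewrite cabsR ger0_norm ?sumr_ge0//.
(* All terms at [t] are nonnegative, so the term of stage [s] is a lower bound. *)
apply: (@lt_le_trans _ _ ((a s)%:R / 2 ^+ s.+1 * t ^+ expo s)); last first.
  by rewrite (bigD1 (Ordinal sS)) //= lerDl sumr_ge0.
rewrite as1 mul1r; apply: (@lt_le_trans _ _ (2 ^+ s.+1)).
  rewrite -natrX ltr_nat (leq_ltn_trans ys)//.
  by apply: ltn_trans (ltn_expl s (ltnSn 1)) _; rewrite ltn_exp2l.
(* With the denominator moved over, the left side is [2 ^+ (2 * s.+1)], that is
   [t ^+ (y.+2 * (2 * s.+1))]; since [y <= s], this exponent is at most [expo s]. *)
rewrite -ler_pdivrMl ?invr_gt0 ?exprn_gt0// invrK -exprD addnn -tE -exprM.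
rewrite ler_weXn2l// /expo leq_mul2r; lia.
Qed.

Theorem theorem3p6 (R : realType) :
  weihrauch_equiv (deg_problem R) closed_choice /\
  weihrauch_equiv (dbnd_problem R) closed_choice /\
  weihrauch_equiv (adv_problem R) closed_choice.
Proof.
split; [|split]; split.
- exact: deg_le_choice.
- exact: choice_le_deg.
- exact: dbnd_le_choice.
- exact: choice_le_dbnd.
- exact: adv_le_choice.
- exact: choice_le_adv.
Qed.
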